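(* Let $\sigma$ be a countable relational signature and $R\in\sigma$ a relation symbol of arity at least $2$. Let $\mathbf P\subseteq\mathbf S_\sigma$ be a property such that: (1) every finite, rigid, connected $\mathcal N\in\mathbf S_\sigma$ with $N\neq\emptyset$ belongs to $\mathbf P$; (2) whenever $I,J$ are sets with $I$ infinite, $\mathcal T_i\cong\mathcal T_R$ for all $i\in I$, $\mathcal T'_j\cong\mathcal T'_R$ for all $j\in J$, and the universes of any two distinct structures from $\{\mathcal T_i:i\in I\}\cup\{\mathcal T'_j:j\in J\}$ are disjoint, then $\bigcup_{i\in I}\mathcal T_i\cup\bigcup_{j\in J}\mathcal T'_j\notin\mathbf P$. Then: (i) $\mathbf P$ cannot be expressed by $FO(\sigma)$; (ii) if $L(\sigma)\geq FO(\sigma)$ is an abstract logic that can express $\mathbf P$, then $L(\sigma)$ does not have the $\aleph_0$-compactness property; (iii) if $L(\sigma)\geq FO(\sigma)$ is an abstract logic that is closed under negation and can express $\mathbf P$, then there is no proof system for $L(\sigma)$ that is both sound and complete.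
   Context: $\sigma$ is a countable signature consisting only of relation symbols, each with an arity; $\mathbf S_\sigma$ is the class of all $\sigma$-structures; calligraphic letters denote structures and the corresponding roman letters their universes. A property is a class $\mathbf P\subseteq\mathbf S_\sigma$ closed under isomorphism. An abstract logic over $\sigma$ is a pair $(L(\sigma),\models_{L(\sigma)})$ where $L(\sigma)$ is a set (some members called sentences) and $\models_{L(\sigma)}\subseteq\mathbf S_\sigma\times L(\sigma)$ is such that isomorphic structures satisfy the same members of $L(\sigma)$. $\mathbf P$ is expressed by $L(\sigma)$ if some sentence $\varphi$ satisfies: $\mathcal M\models_{L(\sigma)}\varphi$ iff $\mathcal M\in\mathbf P$. $L(\sigma)\geq FO(\sigma)$ means every property expressible in first-order logic $FO(\sigma)$ is expressible in $L(\sigma)$. $L(\sigma)$ has the $\aleph_0$-compactness property if every $\Gamma\subseteq L(\sigma)$ with $|\Gamma|\le\aleph_0$ all of whose finite subsets have a model has a model. $L(\sigma)$ is closed under negation if for every sentence $\varphi$ there is a sentence $\psi$ with $\mathcal M\models\varphi$ iff $\mathcal M\not\models\psi$. A proof system is a triple $(\Pi,p,c)$ with $c(\pi)\in L(\sigma)$ and $p(\pi)$ a finite (possibly empty) sequence of members of $L(\sigma)$; it is sound if whenever $p(\pi)=(\varphi_1,\dots,\varphi_k)$ and $c(\pi)=\psi$ are sentences then every model of $\{\varphi_1,\dots,\varphi_k\}$ satisfies $\psi$; it is complete if whenever every model of a set of sentences $\Gamma$ satisfies a sentence $\psi$, there is $\pi$ with $c(\pi)=\psi$ and all members of $p(\pi)$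 in $\Gamma$. Graph notions for a $\sigma$-structure $\mathcal M$: distinct $a,b\in M$ are adjacent if some tuple in some $S^{\mathcal M}$ ($S\in\sigma$) contains both; paths, cycles, connectedness and degree are defined from adjacency. $\mathcal M$ is rigid if its only automorphism is the identity. For $R$ of arity $r\geq2$, an $R$-graph is a $\sigma$-structure with $S^{\mathcal M}=\emptyset$ for $S\neq R$ and such that $(a_1,\dots,a_r)\in R^{\mathcal M}$ implies $a_1\neq a_2$, $a_2=\dots=a_r$ and $(a_2,a_1,\dots,a_1)\in R^{\mathcal M}$; an $R$-tree is a connected $R$-graph with no cycle. $\mathcal T_R$ is an infinite $R$-tree in which exactly one element has degree $4$ and all others have degree $5$; $\mathcal T'_R$ is the infinite $R$-tree in which every element has degree $5$. $\bigcup_i\mathcal M_i$ has universe $\bigcup_iM_i$ and interprets each symbol as the union of its interpretations. *)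

(* Defs.v *)
From Stdlib Require Import List Relations Arith.
Import ListNotations.
Set Implicit Arguments.

Section Sig.
Variable Sym : Type.
Variable ar : Sym -> nat.

Definition countable_type (X : Type) : Prop :=
  exists f : X -> nat, forall x y, f x = f y -> x = y.

Definition finite_type (X : Type) : Prop := exists l : list X, forall x, In x l.
Definition infinite_type (X : Type) : Prop := ~ finite_type X.

Record structure := Struct {
  dom : Type;
  rel : Sym -> list dom -> Prop;
  rel_ar : forall S t, rel S t -> length t = ar S }.

Definition iso (M N : structure) : Prop :=
  exists (f : dom M -> dom N) (g : dom N -> dom M),
    (forall x, g (f x) = x) /\ (forall y, f (g y) = y) /\
    (forall S t, rel M S t <-> rel N S (map f t)).

Definition iso_closed (P : structure -> Prop) : Prop :=
  forall M N, iso M N -> P M -> P N.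

Definition is_automorphism (M : structure) (f : dom M -> dom M) : Prop :=
  (exists g : dom M -> dom M, (forall x, g (f x) = x) /\ (forall y, f (g y) = y)) /\
  (forall S t, rel M S t <-> rel M S (map f t)).

Definition rigid (M : structure) : Prop :=
  forall f, is_automorphism M f -> forall x, f x = x.

Definition finite_str (M : structure) : Prop := finite_type (dom M).
Definition infinite_str (M : structure) : Prop := ~ finite_str M.

Definition adj (M : structure) (a b : dom M) : Prop :=
  a <> b /\ exists S t, rel M S t /\ In a t /\ In b t.

Definition connected (M : structure) : Prop :=
  forall a b, clos_refl_trans (dom M) (adj M) a b.

Fixpoint adj_path (M : structure) (a : dom M) (l : list (dom M)) : Prop :=
  match l with
  | [] => True
  | b :: l' => adj M a b /\ adj_path M b l'
  end.

Definition has_cycle (M : structure) : Prop :=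
  exists (v0 : dom M) (l : list (dom M)),
    NoDup (v0 :: l) /\ 2 <= length l /\ adj_path M v0 l /\ adj M (last l v0) v0.

Definition degree_eq (M : structure) (a : dom M) (n : nat) : Prop :=
  exists l : list (dom M), NoDup l /\ length l = n /\ forall b, adj M a b <-> In b l.

Definition is_Rgraph (R : Sym) (M : structure) : Prop :=
  (forall S t, S <> R -> ~ rel M S t) /\
  (forall t, rel M R t -> exists a b, a <> b /\
      t = a :: repeat b (ar R - 1) /\ rel M R (b :: repeat a (ar R - 1))).

Definition is_Rtree (R : Sym) (M : structure) : Prop :=
  is_Rgraph R M /\ connected M /\ ~ has_cycle M.

Definition is_TR (R : Sym) (M : structure) : Prop :=
  is_Rtree R M /\ infinite_str M /\
  exists a, degree_eq M a 4 /\ forall b, b <> a -> degree_eq M b 5.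

Definition is_TR' (R : Sym) (M : structure) : Prop :=
  is_Rtree R M /\ infinite_str M /\ forall a, degree_eq M a 5.

(* Union of a pairwise-disjoint family of structures; disjointness of the
   universes is realised by tagging (disjoint sum). *)
Section DUnion.
Variables (I J : Type) (T : I -> structure) (T' : J -> structure).
Definition du_dom : Type := ({i : I & dom (T i)} + {j : J & dom (T' j)})%type.
Definition du_rel (S : Sym) (t : list du_dom) : Prop :=
  (exists i (u : list (dom (T i))), rel (T i) S u /\
      t = map (fun x => inl (existT (fun i => dom (T i)) i x)) u) \/
  (exists j (u : list (dom (T' j))), rel (T' j) S u /\
      t = map (fun x => inr (existT (fun j => dom (T' j)) j x)) u).
Lemma du_rel_ar : forall S t, du_rel S t -> length t = ar S.
Proof.
  intros S t [[i [u [Hu ->]]]|[j [u [Hu ->]]]]; rewrite length_map; eapply rel_ar; eauto.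
Qed.
Definition disj_union : structure := @Struct du_dom du_rel du_rel_ar.
End DUnion.

Inductive fo_formula : Type :=
| FEq : nat -> nat -> fo_formula
| FRel : Sym -> list nat -> fo_formula
| FNot : fo_formula -> fo_formula
| FAnd : fo_formula -> fo_formula -> fo_formula
| FOr : fo_formula -> fo_formula -> fo_formula
| FImp : fo_formula -> fo_formula -> fo_formula
| FEx : fo_formula -> fo_formula
| FAll : fo_formula -> fo_formula.

Fixpoint lookup_all (X : Type) (env : list X) (vs : list nat) : option (list X) :=
  match vs with
  | [] => Some []
  | v :: vs' =>
      match nth_error env v, lookup_all env vs' with
      | Some x, Some xs => Some (x :: xs)
      | _, _ => None
      end
  end.

Fixpoint fo_sat (M : structure) (env : list (dom M)) (phi : fo_formula) : Prop :=
  match phi with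
  | FEq i j => exists x, nth_error env i = Some x /\ nth_error env j = Some x
  | FRel s vs => exists t, lookup_all env vs = Some t /\ rel M s t
  | FNot p => ~ fo_sat M env p
  | FAnd p q => fo_sat M env p /\ fo_sat M env q
  | FOr p q => fo_sat M env p \/ fo_sat M env q
  | FImp p q => fo_sat M env p -> fo_sat M env q
  | FEx p => exists x, fo_sat M (x :: env) p
  | FAll p => forall x, fo_sat M (x :: env) p
  end.

Fixpoint fo_wf (n : nat) (phi : fo_formula) : Prop :=
  match phi with
  | FEq i j => i < n /\ j < n
  | FRel _ vs => forall v, In v vs -> v < n
  | FNot p => fo_wf n p
  | FAnd p q | FOr p q | FImp p q => fo_wf n p /\ fo_wf n q
  | FEx p | FAll p => fo_wf (S n) p
  end.

Definition fo_sentence (phi : fo_formula) : Prop := fo_wf 0 phi.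

Definition fo_expresses (P : structure -> Prop) : Prop :=
  exists phi, fo_sentence phi /\ forall M, fo_sat M [] phi <-> P M.

Record abstract_logic := ALogic {
  al_form : Type;
  al_sentence : al_form -> Prop;
  al_sat : structure -> al_form -> Prop;
  al_sat_iso : forall M N phi, iso M N -> (al_sat M phi <-> al_sat N phi) }.

Definition expresses (L : abstract_logic) (P : structure -> Prop) : Prop :=
  exists phi, al_sentence L phi /\ forall M, al_sat L M phi <-> P M.

Definition fo_le (L : abstract_logic) : Prop :=
  forall P, iso_closed P -> fo_expresses P -> expresses L P.

Definition countable_set (X : Type) (G : X -> Prop) : Prop :=
  exists f : nat -> option X, forall x, G x -> exists n, f n = Some x.

Definition al_has_model (L : abstract_logic) (G : al_form L -> Prop) : Prop :=
  exists M, forall phi, G phi -> al_sat L M phi.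

Definition aleph0_compact (L : abstract_logic) : Prop :=
  forall G : al_form L -> Prop, countable_set G ->
    (forall l : list (al_form L), (forall phi, In phi l -> G phi) ->
        al_has_model L (fun phi => In phi l)) ->
    al_has_model L G.

Definition closed_neg (L : abstract_logic) : Prop :=
  forall phi, al_sentence L phi -> exists psi, al_sentence L psi /\
    forall M, al_sat L M phi <-> ~ al_sat L M psi.

Record proof_system (L : abstract_logic) := PSys {
  ps_proofs : Type;
  ps_prem : ps_proofs -> list (al_form L);
  ps_concl : ps_proofs -> al_form L }.

Definition ps_sound (L : abstract_logic) (PS : proof_system L) : Prop :=
  forall pi, al_sentence L (ps_concl PS pi) ->
    (forall phi, In phi (ps_prem PS pi) -> al_sentence L phi) ->
    forall M, (forall phi, In phi (ps_prem PS pi) -> al_sat L M phi) ->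
      al_sat L M (ps_concl PS pi).

Definition ps_complete (L : abstract_logic) (PS : proof_system L) : Prop :=
  forall (G : al_form L -> Prop) psi,
    (forall phi, G phi -> al_sentence L phi) -> al_sentence L psi ->
    (forall M, (forall phi, G phi -> al_sat L M phi) -> al_sat L M psi) ->
    exists pi, ps_concl PS pi = psi /\ forall phi, In phi (ps_prem PS pi) -> G phi.

End Sig.

(* Main.v *)
(* Let Gamma be the first-order theory saying: symbols other than [R] are empty, the structure is an [R]-graph, all degrees are 4 or 5, there are no cycles, distinct vertices of degree 4 are never joined by a walk, and there are infinitely many vertices of degree 4.
   Every model of Gamma is a disjoint union of copies of T_R (infinitely many) and T'_R, so by (2) it is not in P.
   Every finite part of Gamma nevertheless has a finite rigid connected model, which is in P by (1).
   Hence Gamma together with a sentence for P contradicts compactness, and a sound and complete proof system would derive the negation of that sentence from finitely many members of Gamma.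

   The finite rigid graphs arise as follows.
   In a finite base graph B with one vertex of degree 4 and all others of degree 5, arrange that every vertex is definable from the one of degree 4 by Boolean operations and "has a neighbour in"; B may have short cycles, but only far from that vertex.
   A finite cover of B of large girth has locally the same structure, so its automorphisms preserve the fibres of the covering.
   Removing one edge of the cover, far from the vertices of degree 4, kills the remaining symmetries: its ends are recognisable as the vertices of degree 4 close to two others, so an automorphism fixes them, and then fixes everything by unique lifting. *)
Require Import Defs.
From Stdlib Require Import List Relations Arith Lia Classical ClassicalEpsilon.
From Stdlib Require Import ProofIrrelevance FunctionalExtensionality PropExtensionality.
From mathcomp Require filter.
Import ListNotations.
Set Implicit Arguments.

(** * Non-backtracking walks *)

(** The obstacle is to have rigidity, connectedness and large girth at once. A base whose vertices
    are all definable does not give a rigid cover: deck transformations preserve every fibre and may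
    still move points, and only the removed edge excludes them. Definability is by neighbourhood
    conditions, and not by rigidity of the base, because an automorphism of the cover need not
    descend to the base, whereas such conditions lift through any covering. The cover is the
    classical construction of graphs of large girth: colour the edges of the base properly, let each
    colour act as an involution on a ball in a regular tree, and compose these involutions along
    walks. Giving the edge between [a] and [b] the colour [a + b] is already a proper colouring. The
    base is a deep heap with its leaves on a circle, so vertices of degree 4 are far apart; a single
    vertex with children at the depth of the leaves breaks its symmetry. The finite models form one
    sequence in which each axiom holds from some index on. An ultraproduct over [nat] therefore
    settles first-order logic, and late members of the sequence serve all finite subsets in other
    logics. *)

Section Walks.
Variables (V : Type) (E : V -> V -> Prop).

(** Trees, girth and distances are phrased by these walks instead of simple paths: the condition is
    local, hence easy to glue, to lift and to write in first-order logic. *)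
Fixpoint nbwalk (l : list V) : Prop :=
  match l with
  | x :: ((y :: l') as m) =>
      E x y /\ match l' with z :: _ => x <> z | [] => True end /\ nbwalk m
  | _ => True
  end.

(** The turn at the base point is not restricted. In a loopless symmetric graph a shortest
    nontrivial closed walk of this kind is a cycle, so this is the usual girth condition. *)
Definition girth_gt (r : nat) : Prop :=
  forall x l, nbwalk (x :: l) -> last l x = x -> length l <= r -> l = [].

Definition nb_within (k : nat) (x y : V) : Prop :=
  exists l, nbwalk (x :: l) /\ last l x = y /\ length l <= k.

Definition degree (x : V) (d : nat) : Prop :=
  exists l, NoDup l /\ length l = d /\ forall y, E x y <-> In y l.

Lemma last_cons_default (x y : V) (l : list V) : last (y :: l) x = last l y.
Proof.
  revert x y; induction l as [|z l IH]; intros x y; [reflexivity|].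
  change (last (z :: l) x = last (z :: l) y). now rewrite !IH.
Qed.

Lemma last_app_cons (l l' : list V) (y d : V) : last (l ++ y :: l') d = last l' y.
Proof.
  induction l as [|a l IH]; cbn [app].
  - apply last_cons_default.
  - rewrite last_cons_default.
    destruct l as [|b l]; cbn [app] in *; rewrite last_cons_default.
    + reflexivity.
    + now rewrite last_cons_default in IH.
Qed.

Lemma nbwalk_tail x l : nbwalk (x :: l) -> nbwalk l.
Proof. destruct l; simpl; tauto. Qed.

(** The pieces share an edge and not just a vertex, so every turn lies within one of them. *)
Lemma nbwalk_glue l1 a b l2 :
  nbwalk (l1 ++ [a; b]) -> nbwalk (a :: b :: l2) -> nbwalk (l1 ++ a :: b :: l2).
Proof.
  induction l1 as [|c l1 IH]; [tauto|].
  destruct l1 as [|d [|e l1]]; simpl in *; tauto.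
Qed.

Hypothesis Esym : forall x y, E x y -> E y x.

Lemma nbwalk_rev l : nbwalk l -> nbwalk (rev l).
Proof.
  induction l as [|x l IH]; [easy|].
  destruct l as [|y [|z l]].
  - easy.
  - simpl. intuition auto.
  - intros (Hxy & Hxz & H). specialize (IH H).
    simpl in *. rewrite <- !app_assoc in *. simpl in *.
    apply nbwalk_glue; [exact IH|]. simpl. intuition auto.
Qed.

(* If two walks first diverge at [x], going back along the first and then along the second is a closed non-backtracking walk. *)
Lemma nbwalk_unique r (G : girth_gt r) l1 : forall l2 x,
  nbwalk (x :: l1) -> nbwalk (x :: l2) -> last l1 x = last l2 x ->
  length l1 + length l2 <= r -> l1 = l2.
Proof.
  induction l1 as [|y l1 IH]; intros l2 x W1 W2 HL Hr.
  { symmetry. apply (G x); auto. }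
  destruct l2 as [|z l2].
  { apply (G x); auto. simpl in *; lia. }
  destruct (classic (y = z)) as [<-|Hyz].
  { f_equal. apply (IH l2 y).
    - exact (nbwalk_tail _ _ W1).
    - exact (nbwalk_tail _ _ W2).
    - now rewrite !last_cons_default in HL.
    - simpl in Hr. lia. }
  exfalso.
  destruct (exists_last (l := y :: l1)) as (l1' & b & Hb); [easy|].
  assert (Hyx : E y x) by (simpl in W1; apply Esym; tauto).
  apply nbwalk_rev in W1.
  assert (W : nbwalk (b :: rev l1' ++ x :: z :: l2)).
  { replace (b :: rev l1' ++ x :: z :: l2) with (rev l1 ++ y :: x :: z :: l2).
    - apply nbwalk_glue.
      + simpl in W1. rewrite <- app_assoc in W1. exact W1.
      + simpl in W2 |- *. intuition auto.
    - replace (rev l1 ++ y :: x :: z :: l2) with (rev (y :: l1) ++ x :: z :: l2)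
        by (simpl; now rewrite <- app_assoc).
      rewrite Hb, rev_app_distr. reflexivity. }
  apply (app_cons_not_nil (rev l1') (z :: l2) x). symmetry. apply (G b); [exact W| |].
  - now rewrite last_app_cons, <- HL, Hb, last_app_cons.
  - rewrite length_app, length_rev.
    assert (length (y :: l1) = S (length l1')) by (rewrite Hb, length_app; simpl; lia).
    simpl in *. lia.
Qed.

(** The new edge either extends the walk or cancels against its first step. *)
Lemma nb_within_step k x y z : E x y -> nb_within k y z -> nb_within (S k) x z.
Proof.
  intros Hxy (l & W & HL & Hk).
  destruct l as [|a l].
  - exists [y]. simpl in *. subst z. repeat split; auto; lia.
  - destruct (classic (x = a)) as [<-|Ha].
    + exists l. rewrite last_cons_default in HL. apply nbwalk_tail in W. simpl in Hk.
      repeat split; auto; lia.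
    + exists (y :: a :: l). rewrite last_cons_default. simpl in *. repeat split; auto; try tauto; lia.
Qed.

Lemma connected_nb_within x y : clos_refl_trans V E x y -> exists k, nb_within k x y.
Proof.
  intros H. apply clos_rt_rt1n in H. induction H as [x|x y z Hxy _ [k IH]].
  - exists 0, []. simpl; auto.
  - exists (S k). eapply nb_within_step; eauto.
Qed.

Lemma clos_rt_sym x y : clos_refl_trans V E x y -> clos_refl_trans V E y x.
Proof.
  intros H; induction H as [x y Hxy|x|x y z _ IH1 _ IH2].
  - apply rt_step; auto.
  - apply rt_refl.
  - eapply rt_trans; eauto.
Qed.

End Walks.
Arguments nbwalk_tail [V E] x l _.
Arguments nbwalk_rev [V E] Esym l _.

Lemma nbwalk_mono (V : Type) (E E' : V -> V -> Prop) (HE : forall x y, E x y -> E' x y) l :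
  nbwalk E l -> nbwalk E' l.
Proof.
  induction l as [|x [|y l] IH]; simpl; intuition auto.
Qed.

Lemma finite_sig (X : Type) (P : X -> Prop) (l : list X) :
  (forall x, P x -> In x l) -> finite_type {x | P x}.
Proof.
  intros H.
  exists (flat_map (fun x => match excluded_middle_informative (P x) with
                             | left p => [exist _ x p] | right _ => [] end) l).
  intros [x p]. apply in_flat_map. exists x. split; [auto|].
  destruct (excluded_middle_informative (P x)) as [q|q]; [|tauto].
  left. now rewrite (proof_irrelevance _ q p).
Qed.

Fixpoint lists_of_length (X : Type) (l : list X) (n : nat) : list (list X) :=
  match n with
  | 0 => [[]]
  | S n => flat_map (fun t => map (fun x => x :: t) l) (lists_of_length l n)
  end.

Lemma in_lists_of_length (X : Type) (l t : list X) :
  incl t l -> In t (lists_of_length l (length t)).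
Proof.
  induction t as [|x t IH]; simpl; [tauto|]. intros H.
  apply in_flat_map. exists t. split.
  - apply IH. intros y Hy; apply H; simpl; auto.
  - apply (in_map (fun x => x :: t)), H; simpl; auto.
Qed.

(** * Finite covers of large girth *)

Record covering (A : nat -> nat -> Prop) (V : Type) (E : V -> V -> Prop) (p : V -> nat) : Prop := {
  cov_adj : forall v w, E v w -> A (p v) (p w);
  cov_lift : forall v b, A (p v) b -> exists w, E v w /\ p w = b;
  cov_inj : forall v w w', E v w -> E v w' -> p w = p w' -> w = w' }.

(** * Involutions on the reduced words of bounded length *)

Section Words.
Variables (r K : nat).

Fixpoint reduced (w : list nat) : Prop :=
  match w with
  | a :: ((b :: _) as m) => a <> b /\ reduced m
  | _ => True
  end.

Definition good_word (w : list nat) : Prop :=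
  length w <= r /\ reduced w /\ forall a, In a w -> a < K.

(** Left multiplication by a generator of order two, restricted to the ball of radius [r] in a free
    product of groups of order two. A word that would leave the ball is fixed, which keeps the map
    an involution. *)
Definition toggle (c : nat) (w : list nat) : list nat :=
  match w with
  | a :: w' => if a =? c then w' else if length w <? r then c :: w else w
  | [] => if 0 <? r then [c] else []
  end.

Lemma toggle_good c w : c < K -> good_word w -> good_word (toggle c w).
Proof.
  intros Hc (Hl & Hr & Hk). unfold good_word. destruct w as [|a w].
  - simpl. destruct (Nat.ltb_spec 0 r); simpl; repeat split; try lia; tauto.
  - unfold toggle. destruct (Nat.eqb_spec a c) as [->|Hac].
    + simpl in Hl. repeat split; [lia| |intros; apply Hk; simpl; auto].
      destruct w; simpl in *; tauto.
    + destruct (Nat.ltb_spec (length (a :: w)) r); [|repeat split; auto].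
      repeat split; auto.
      intros b [<-|Hb]; auto.
Qed.

Lemma toggle_involutive c w : good_word w -> toggle c (toggle c w) = w.
Proof.
  intros (Hl & Hr & _). destruct w as [|a w].
  - simpl. destruct (Nat.ltb_spec 0 r); simpl.
    + now rewrite Nat.eqb_refl.
    + destruct (Nat.ltb_spec 0 r); [lia|reflexivity].
  - unfold toggle at 2. destruct (Nat.eqb_spec a c) as [->|Hac].
    + simpl in Hl. destruct w as [|b w]; unfold toggle.
      * destruct (Nat.ltb_spec 0 r); [reflexivity|simpl in Hl; lia].
      * destruct Hr as [Hcb _]. destruct (Nat.eqb_spec b c); [congruence|].
        destruct (Nat.ltb_spec (length (b :: w)) r); [reflexivity|simpl in *; lia].
    + destruct (Nat.ltb_spec (length (a :: w)) r) as [H|H].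
      * simpl. now rewrite Nat.eqb_refl.
      * unfold toggle. destruct (Nat.eqb_spec a c); [congruence|].
        destruct (Nat.ltb_spec (length (a :: w)) r); [lia|reflexivity].
Qed.

Lemma good_words_finite : exists l, forall w, In w l <-> good_word w.
Proof.
  set (all := flat_map (lists_of_length (seq 0 K)) (seq 0 (S r))).
  exists (filter (fun w => if excluded_middle_informative (good_word w) then true else false) all).
  intros w. rewrite filter_In.
  destruct (excluded_middle_informative (good_word w)) as [H|H]; [|intuition congruence].
  split; [tauto|]. intros _. split; [|reflexivity].
  destruct H as (Hl & _ & Hk). apply in_flat_map. exists (length w). split.
  - apply in_seq; lia.
  - apply in_lists_of_length. intros a Ha. apply in_seq. specialize (Hk a Ha); lia.
Qed.

End Words.

(** * The cover on which these involutions act along walks *)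

Section Cover.
Variables (A : nat -> nat -> Prop) (N r : nat).
Hypothesis Asym : forall a b, A a b -> A b a.
Hypothesis Abound : forall a b, A a b -> a < N.

Let K := N + N.
Let state := list (list nat).

(** A permutation of the ball, written as the list of its values: each position follows the fate of
    one word. *)
Definition good_state (L : nat) (y : state) : Prop :=
  length y = L /\ (forall w, In w y <-> good_word r K w).

(** The label [fst u + fst v] is symmetric, so going back applies the same involution again; at a
    fixed vertex it determines the other end, so distinct edges there have distinct labels. *)
Definition cover_step (u v : nat * state) : Prop :=
  A (fst u) (fst v) /\ snd v = map (toggle r (fst u + fst v)) (snd u).

Lemma cover_step_good L u v : cover_step u v -> good_state L (snd u) -> good_state L (snd v).
Proof.
  intros [HA ->] [HL HG]. split; [now rewrite length_map|].
  assert (Hc : fst u + fst v < K).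
  { unfold K. generalize (Abound HA) (Abound (Asym HA)). lia. }
  intros w. rewrite in_map_iff. split.
  - intros (w' & <- & Hw'). apply toggle_good; auto. now apply HG.
  - intros Hw. exists (toggle r (fst u + fst v) w). split.
    + eapply toggle_involutive; eauto.
    + apply HG, toggle_good; auto.
Qed.

Lemma cover_step_sym L u v : good_state L (snd u) -> cover_step u v -> cover_step v u.
Proof.
  intros [_ HG] [HA Hv]. split; [auto|].
  rewrite Hv, map_map, (Nat.add_comm (fst v)).
  rewrite (map_ext_in _ (fun w => w)); [now rewrite map_id|].
  intros w Hw. apply toggle_involutive with (K := K). now apply HG.
Qed.

Definition cover_reach (base : nat * state) : nat * state -> Prop :=
  clos_refl_trans _ cover_step base.

Lemma cover_reach_good L base u :
  good_state L (snd base) -> cover_reach base u -> good_state L (snd u).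
Proof.
  intros H HR. apply clos_rt_rtn1 in HR. induction HR; auto.
  eapply cover_step_good; eauto.
Qed.

Definition cover_edge (base : nat * state) (u v : {u | cover_reach base u}) : Prop :=
  cover_step (proj1_sig u) (proj1_sig v).

Let cls (base : nat * state) (u : {u | cover_reach base u}) : nat := fst (proj1_sig u).

Lemma cover_edge_sym L base (H : good_state L (snd base)) u v :
  @cover_edge base u v -> cover_edge v u.
Proof.
  apply (@cover_step_sym L). eapply cover_reach_good; [eauto|]. exact (proj2_sig u).
Qed.

Lemma cover_covering base : covering A (@cover_edge base) (@cls base).
Proof.
  split.
  - intros v w [H _]; exact H.
  - intros [v Hv] b Hb. unfold cls in *; simpl in *.
    assert (Hs : cover_step v (b, map (toggle r (fst v + b)) (snd v))) by (split; auto).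
    exists (exist _ _ (rt_trans _ _ _ _ _ Hv (rt_step _ _ _ _ Hs))).
    split; [exact Hs|reflexivity].
  - intros [v Hv] [[w1 w2] Hw] [[x1 x2] Hx] [_ H1] [_ H2] E. simpl in *.
    unfold cls in E. simpl in E. subst. now rewrite (proof_irrelevance _ Hw Hx).
Qed.

(* A word in the state records the labels crossed: no cancellation occurs along a non-backtracking walk. *)
Lemma cover_walk_word L base (HB : good_state L (snd base)) i l : forall u v w,
  nbwalk (@cover_edge base) (u :: v :: l) ->
  nth_error (snd (proj1_sig v)) i = Some w -> hd_error w = Some (cls u + cls v) ->
  length w + length l <= r ->
  exists w', nth_error (snd (proj1_sig (last l v))) i = Some w' /\
             length w' = length w + length l.
Proof.
  induction l as [|x l IH]; intros u v w HW Hi Hh Hr.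
  { exists w. simpl. split; [auto|lia]. }
  rewrite last_cons_default.
  destruct (IH v x ((cls v + cls x) :: w)) as (w' & H1 & H2).
  - exact (nbwalk_tail _ _ HW).
  - destruct HW as (Huv & Hux & [HA Hx] & _).
    rewrite Hx, nth_error_map, Hi. simpl. f_equal.
    destruct w as [|a w]; [discriminate|]. simpl in Hh. injection Hh as ->.
    unfold toggle. fold (cls v) (cls x).
    destruct (Nat.eqb_spec (cls u + cls v) (cls v + cls x)) as [e|e].
    + exfalso. apply Hux. destruct (cover_covering base) as [_ _ Hinj].
      apply (Hinj v); [eapply cover_edge_sym; eauto|split; auto|lia].
    + destruct (Nat.ltb_spec (length (cls u + cls v :: w)) r); [reflexivity|].
      simpl in *; lia.
  - reflexivity.
  - simpl in *; lia.
  - exists w'. split; auto. simpl in *. lia.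
Qed.

Theorem covering_exists (b0 : nat) : b0 < N ->
  exists (V : Type) (E : V -> V -> Prop) (p : V -> nat),
    covering A E p /\ (forall v, p v < N) /\ finite_type V /\ (forall v w, E v w -> E w v) /\
    (forall v w, clos_refl_trans V E v w) /\ girth_gt E r /\ exists v, p v = b0.
Proof.
  intros Hb0.
  destruct (good_words_finite r K) as [y0 Hy0].
  set (base := (b0, y0)).
  assert (HB : good_state (length y0) (snd base)) by (split; auto).
  assert (Hgood := fun u : {u | cover_reach base u} =>
            cover_reach_good HB (proj2_sig u)).
  assert (Hsym := fun u v => @cover_edge_sym _ base HB u v).
  exists {u | cover_reach base u}, (@cover_edge base), (@cls base).
  assert (Hcls : forall u, cover_reach base u -> fst u < N).
  { intros u Hu. apply clos_rt_rtn1 in Hu. destruct Hu as [|u v [HA _]].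
    - exact Hb0.
    - exact (Abound (Asym HA)). }
  split; [apply cover_covering|]. split; [intros [u Hu]; apply Hcls, Hu|].
  split; [|split; [exact Hsym|split; [|split]]].
  - apply finite_sig with (l := list_prod (seq 0 N) (lists_of_length y0 (length y0))).
    intros [b y] Hu. apply in_prod.
    + apply in_seq. specialize (Hcls _ Hu). simpl in Hcls. lia.
    + destruct (cover_reach_good HB Hu) as [HL HG]. simpl in *. rewrite <- HL.
      apply in_lists_of_length. intros w Hw. now apply Hy0, HG.
  - assert (H0 : forall v, clos_refl_trans _ (@cover_edge base)
                             (exist _ base (rt_refl _ _ _)) v).
    { intros [v Hv]. assert (Hv' := Hv). apply clos_rt_rtn1 in Hv'.
      induction Hv' as [|v w Hs Hv' IH].
      - rewrite (proof_irrelevance _ Hv (rt_refl _ _ _)). apply rt_refl.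
      - apply rt_trans with (exist _ v (clos_rtn1_rt _ _ _ _ Hv')); [apply IH|].
        apply rt_step. exact Hs. }
    intros v w. eapply rt_trans; [|apply H0]. apply clos_rt_sym; auto.
  - intros v [|x l] HW HL Hr; [reflexivity|exfalso].
    (* A state lists all good words, so some position holds the empty word at the start; a short
       walk leaves a nonempty word there and cannot return to the same state. *)
    destruct (In_nth_error (snd (proj1_sig v)) []) as [i Hi].
    { apply Hgood. repeat split; simpl; try lia; tauto. }
    destruct (@cover_walk_word _ base HB i l v x [cls v + cls x]) as (w & H1 & H2).
    + exact HW.
    + destruct HW as ([_ Hx] & _). rewrite Hx, nth_error_map, Hi. simpl.
      destruct (Nat.ltb_spec 0 r); [reflexivity|simpl in Hr; lia].
    + reflexivity.
    + simpl in *; lia.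
    + rewrite last_cons_default in HL. rewrite HL, Hi in H1. injection H1 as <-.
      simpl in H2. lia.
  - exists (exist _ base (rt_refl _ _ _)). reflexivity.
Qed.

End Cover.

(** * The base graph *)

(* Vertices [0 .. 4 M]: a 4-ary heap whose leaves [M .. 4 M] are placed on a circle, each joined to those at circular distance 1 and 2. *)
Definition heap_adj (M i j : nat) : Prop :=
  i <= 4 * M /\ j <= 4 * M /\
  ((4 * i + 1 <= j <= 4 * i + 4) \/ (4 * j + 1 <= i <= 4 * j + 4) \/
   (M <= i /\ M <= j /\
    (i + 1 = j \/ i + 2 = j \/ j + 1 = i \/ j + 2 = i \/
     i + 3 * M = j \/ i + 3 * M = j + 1 \/ j + 3 * M = i \/ j + 3 * M = i + 1))).

(* [heap_start h] is the first heap index at depth [h], i.e. [(4 ^ h - 1) / 3]. *)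
Fixpoint heap_start (h : nat) : nat :=
  match h with 0 => 0 | S h => 4 * heap_start h + 1 end.

Lemma heap_start_le h h' : h <= h' -> heap_start h <= heap_start h'.
Proof. induction 1; simpl; lia. Qed.

Lemma heap_adj_sym M i j : heap_adj M i j -> heap_adj M j i.
Proof. unfold heap_adj. lia. Qed.

Lemma heap_parent i : 1 <= i -> exists q, 4 * q + 1 <= i <= 4 * q + 4.
Proof.
  intros H. exists ((i - 1) / 4).
  generalize (Nat.div_mod (i - 1) 4) (Nat.mod_upper_bound (i - 1) 4). lia.
Qed.

Lemma heap_degree_root M : 2 <= M -> degree (heap_adj M) 0 4.
Proof.
  intros HM. exists [1; 2; 3; 4]. split; [|split].
  - repeat constructor; simpl; lia.
  - reflexivity.
  - intros j. unfold heap_adj. simpl. lia.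
Qed.

Lemma heap_degree M i : 2 <= M -> 1 <= i <= 4 * M -> degree (heap_adj M) i 5.
Proof.
  intros HM Hi. destruct (heap_parent (proj1 Hi)) as [q Hq].
  destruct (Nat.lt_ge_cases i M) as [H|H].
  - exists [q; 4 * i + 1; 4 * i + 2; 4 * i + 3; 4 * i + 4]. split; [|split].
    + repeat constructor; simpl; lia.
    + reflexivity.
    + intros j. unfold heap_adj. simpl. lia.
  - exists [q; if i =? 4 * M then M else i + 1;
            if 4 * M <=? i + 1 then i + 1 - 3 * M else i + 2;
            if i =? M then 4 * M else i - 1;
            if i <=? M + 1 then i + 3 * M - 1 else i - 2].
    destruct (Nat.eqb_spec i (4 * M)), (Nat.leb_spec (4 * M) (i + 1)),
      (Nat.eqb_spec i M), (Nat.leb_spec i (M + 1)); try lia;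
    (split; [repeat constructor; simpl; lia|]);
    (split; [reflexivity|]); intros j; unfold heap_adj; simpl; lia.
Qed.

(** * Every vertex of the base is definable from the root *)

Section Classes.
Variables (h M : nat).
Hypothesis Hh : 2 <= h.
Hypothesis HM : M = heap_start h + 1.
Variables (V : Type) (E : V -> V -> Prop) (p : V -> nat).
Hypothesis C : covering (heap_adj M) E p.
Hypothesis Hp : forall v, p v <= 4 * M.
Variables (f g : V -> V).
Hypothesis fg : forall v, f (g v) = v.
Hypothesis fE : forall v w, E v w <-> E (f v) (f w).
Hypothesis f0 : forall v, p v = 0 <-> p (f v) = 0.

(** The union of the fibres over [X] is preserved by [f]. Sets with this property are closed under
    Boolean operations and under taking neighbours; the starting point is [f0]. *)
Let inv (X : nat -> Prop) : Prop := forall v, X (p v) <-> X (p (f v)).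

Lemma inv_ext (X Y : nat -> Prop) : (forall b, b <= 4 * M -> (X b <-> Y b)) -> inv X -> inv Y.
Proof.
  intros H HX v. rewrite <- !H by auto. apply HX.
Qed.

Lemma inv_not (X : nat -> Prop) : inv X -> inv (fun b => ~ X b).
Proof. intros HX v. specialize (HX v). tauto. Qed.

Lemma inv_and (X Y : nat -> Prop) : inv X -> inv Y -> inv (fun b => X b /\ Y b).
Proof. intros HX HY v. specialize (HX v). specialize (HY v). tauto. Qed.

Lemma inv_or (X Y : nat -> Prop) : inv X -> inv Y -> inv (fun b => X b \/ Y b).
Proof. intros HX HY v. specialize (HX v). specialize (HY v). tauto. Qed.

(** A neighbour in the base lifts to a neighbour in the cover, is moved there by [f] or by [g], and
    is projected again. *)
Lemma inv_dia (X : nat -> Prop) : inv X -> inv (fun b => exists c, heap_adj M b c /\ X c).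
Proof.
  intros HX v. split; intros (c & Hc & Xc).
  - destruct (cov_lift C _ _ Hc) as (w & Hw & <-). exists (p (f w)). split.
    + apply (cov_adj C). now apply -> fE.
    + exact (proj1 (HX w) Xc).
  - destruct (cov_lift C _ _ Hc) as (w & Hw & <-). exists (p (g w)). split.
    + apply (cov_adj C). apply fE. now rewrite fg.
    + apply (HX (g w)). now rewrite fg.
Qed.

(** A vertex has depth at most [k] iff it is the root or has a neighbour of depth less than [k]. The
    bound keeps circle edges out: they join leaves, which have depth at least [h]. *)
Lemma inv_below k : k <= h + 1 -> inv (fun b => b < heap_start k).
Proof.
  induction k as [|k IH]; intros Hk.
  { intros v; simpl; lia. }
  assert (heap_start k <= heap_start h) by (apply heap_start_le; lia).
  apply inv_ext with (fun b => b = 0 \/ exists c, heap_adj M b c /\ c < heap_start k).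
  - intros b Hb. simpl. split.
    + intros [->|(c & Hc & Hck)]; [lia|]. unfold heap_adj in Hc. lia.
    + intros H'. destruct (Nat.eq_dec b 0) as [|Hb0]; [auto|right].
      destruct (heap_parent (i := b)) as [q Hq]; [lia|].
      exists q. unfold heap_adj. lia.
  - apply inv_or; [exact f0|]. apply inv_dia, IH. lia.
Qed.

(** By the choice of [M], the vertex [M - 1] is the first one at depth [h], and its four children
    are all of depth [h + 1]. These are the [deep] vertices; [level] is depth [h]. *)
Let deep b := 4 * M - 3 <= b.
Let level b := M - 1 <= b < 4 * M - 3.

Lemma M_large : 6 <= M.
Proof.
  assert (heap_start 2 <= heap_start h) by now apply heap_start_le.
  simpl in *. lia.
Qed.

Lemma inv_deep : inv deep.
Proof.
  apply inv_ext with (fun b => ~ b < heap_start (h + 1)); [|now apply inv_not, inv_below].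
  intros b Hb. unfold deep. rewrite Nat.add_1_r. simpl. lia.
Qed.

Lemma inv_level : inv level.
Proof.
  apply inv_ext with (fun b => ~ b < heap_start h /\ ~ deep b).
  - intros b Hb. unfold level, deep. lia.
  - apply inv_and; apply inv_not; [apply inv_below; lia|exact inv_deep].
Qed.

(* [M - 1] is the only internal vertex at its depth, hence the only one without neighbours there. *)
Lemma inv_extended : inv (fun b => b = M - 1).
Proof.
  pose proof M_large.
  apply inv_ext with (fun b => level b /\ ~ exists c, heap_adj M b c /\ level c).
  - intros b Hb. unfold level. split.
    + intros [H1 H2]. destruct (Nat.eq_dec b (M - 1)) as [|Hn]; [auto|exfalso].
      apply H2. destruct (Nat.eq_dec b M) as [->|].
      * exists (M + 1). unfold heap_adj; lia.
      * exists (b - 1). unfold heap_adj; lia.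
    + intros ->. split; [lia|]. intros (c & Hc & Hl). unfold heap_adj in Hc. lia.
  - apply inv_and; [apply inv_level|]. apply inv_not, inv_dia, inv_level.
Qed.

(** The three siblings of [M - 1]. *)
Let block b := M <= b <= M + 2.

Lemma inv_block : inv block.
Proof.
  pose proof M_large.
  assert (Hk : heap_start h = 4 * heap_start (h - 1) + 1).
  { replace h with (S (h - 1)) at 1 by lia. reflexivity. }
  apply inv_ext with (fun b => (level b /\ b <> M - 1) /\
    exists c, heap_adj M b c /\ c < heap_start h /\ exists d, heap_adj M c d /\ d = M - 1).
  - intros b Hb. unfold level, block. split.
    + intros ([H1 H2] & c & Hc & Hcl & d & Hd & ->). unfold heap_adj in *. lia.
    + intros Hb'. split; [lia|]. exists (heap_start (h - 1)). split; [unfold heap_adj; lia|].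
      split; [lia|]. exists (M - 1). unfold heap_adj. lia.
  - apply inv_and; [apply inv_and; [apply inv_level|]|].
    + apply inv_not, inv_extended.
    + apply inv_dia, inv_and; [apply inv_below; lia|]. apply inv_dia, inv_extended.
Qed.

(** The circle tells the siblings apart: of the three, only [M + 2] is more than two places away
    from the deep leaf [4 * M], and of the other two only [M + 1] reaches [M + 3]. *)
Lemma inv_start : inv (fun b => b = M) /\ inv (fun b => b = M + 1) /\ inv (fun b => b = M + 2).
Proof.
  pose proof M_large.
  assert (H2 : inv (fun b => b = M + 2)).
  { apply inv_ext with (fun b => block b /\ ~ exists c, heap_adj M b c /\ deep c).
    - intros b Hb. unfold block, deep. split.
      + intros [H1 H2]. destruct (Nat.eq_dec b (M + 2)) as [|Hn]; [auto|exfalso].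
        apply H2. exists (4 * M). unfold heap_adj; lia.
      + intros ->. split; [lia|]. intros (c & Hc & Hl). unfold heap_adj in Hc. lia.
    - apply inv_and; [apply inv_block|]. apply inv_not, inv_dia, inv_deep. }
  assert (H1 : inv (fun b => b = M + 1)).
  { apply inv_ext with (fun b => (block b /\ b <> M + 2) /\
      exists c, heap_adj M b c /\ (level c /\ ~ block c) /\ c <> M - 1).
    - intros b Hb. unfold block, level. split.
      + intros ([H1 H3] & c & Hc & Hl & Hn). unfold heap_adj in Hc. lia.
      + intros ->. split; [lia|]. exists (M + 3). unfold heap_adj. lia.
    - apply inv_and; [apply inv_and; [apply inv_block|apply inv_not, H2]|].
      apply inv_dia, inv_and; [apply inv_and; [apply inv_level|apply inv_not, inv_block]|].
      apply inv_not, inv_extended. }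
  split; [|split; auto].
  apply inv_ext with (fun b => (block b /\ b <> M + 2) /\ b <> M + 1).
  - intros b Hb. unfold block. lia.
  - apply inv_and; [apply inv_and; [apply inv_block|apply inv_not, H2]|apply inv_not, H1].
Qed.

(** Two consecutive leaves have exactly two common neighbours on the circle, one on each side. Once
    the earlier one is identified, so is the next; hence the induction carries three leaves. *)
Lemma inv_leaf k : M + k + 2 <= 4 * M ->
  inv (fun b => b = M + k) /\ inv (fun b => b = M + k + 1) /\ inv (fun b => b = M + k + 2).
Proof.
  pose proof M_large.
  induction k as [|k IH]; intros Hk.
  { rewrite !Nat.add_0_r. exact inv_start. }
  destruct IH as (I0 & I1 & I2); [lia|].
  split; [|split].
  - eapply inv_ext; [|exact I1]. intros b Hb. cbv beta. lia.
  - eapply inv_ext; [|exact I2]. intros b Hb. cbv beta. lia.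
  - apply inv_ext with (fun b => ((~ b < heap_start h /\ b <> M - 1) /\ b <> M + k) /\
      (exists c, heap_adj M b c /\ c = M + k + 1) /\ (exists c, heap_adj M b c /\ c = M + k + 2)).
    + intros b Hb. split.
      * intros (H1 & (c & Hc & ->) & (d & Hd & ->)). unfold heap_adj in *. lia.
      * intros ->. split; [lia|]. split; eexists; (split; [|reflexivity]); unfold heap_adj; lia.
    + apply inv_and; [|apply inv_and; apply inv_dia; assumption].
      apply inv_and; [|apply inv_not, I0].
      apply inv_and; apply inv_not; [apply inv_below; lia|apply inv_extended].
Qed.

(** After the leaves come the internal vertices, by decreasing index: when all larger vertices are
    identified, [b] is the only remaining neighbour of its child [4 * b + 1]. *)
Lemma inv_singleton k : forall b, b <= 4 * M -> 4 * M - b <= k -> inv (fun c => c = b).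
Proof.
  pose proof M_large.
  induction k as [|k IH]; intros b Hb Hk.
  { replace b with (M + (3 * M - 2) + 2) by lia. apply inv_leaf. lia. }
  destruct (Nat.le_gt_cases M b) as [Hl|Hl].
  { destruct (Nat.le_gt_cases (M + 2) b).
    - replace b with (M + (b - M - 2) + 2) by lia. apply inv_leaf. lia.
    - destruct inv_start as (I0 & I1 & _). destruct (Nat.eq_dec b M) as [->|]; [exact I0|].
      replace b with (M + 1) by lia. exact I1. }
  assert (Hab : inv (fun c => b < c)).
  { intros v. split; intros Hv.
    - assert (IHv := IH (p v) (Hp v) ltac:(lia) v). cbv beta in IHv.
      rewrite (proj1 IHv eq_refl). exact Hv.
    - assert (IHv := IH (p (f v)) (Hp (f v)) ltac:(lia) v). cbv beta in IHv.
      rewrite (proj2 IHv eq_refl). exact Hv. }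
  apply inv_ext with (fun c => ~ b < c /\ exists d, heap_adj M c d /\ d = 4 * b + 1).
  - intros c Hc. split.
    + intros (H1 & d & Hd & ->). unfold heap_adj in Hd. lia.
    + intros ->. split; [lia|]. eexists; split; [|reflexivity]. unfold heap_adj; lia.
  - apply inv_and; [now apply inv_not|]. apply inv_dia, IH; lia.
Qed.

Theorem automorphism_preserves_class v : p (f v) = p v.
Proof.
  apply (inv_singleton (k := 4 * M - p v) (Hp v) ltac:(lia) v). reflexivity.
Qed.

End Classes.

(** * Finite rigid graphs *)

Section Degrees.
Variables (V : Type) (E : V -> V -> Prop).

Lemma degree_unique x d d' : degree E x d -> degree E x d' -> d = d'.
Proof.
  intros (l & Nl & <- & Hl) (l' & Nl' & <- & Hl').
  apply Nat.le_antisymm; apply NoDup_incl_length; auto; intros y Hy.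
  - now apply Hl', Hl.
  - now apply Hl, Hl'.
Qed.

Lemma degree_remove (E' : V -> V -> Prop) x y d :
  degree E x (S d) -> E x y -> (forall z, E' x z <-> E x z /\ z <> y) -> degree E' x d.
Proof.
  intros (l & Nl & HL & Hl) Hxy H.
  destruct (in_split y l) as (l1 & l2 & ->); [now apply Hl|].
  exists (l1 ++ l2). split; [|split].
  - eapply NoDup_remove_1; eauto.
  - rewrite length_app in *. simpl in HL. lia.
  - intros z. rewrite H, Hl, !in_app_iff. simpl. split.
    + intros [[Hz|[Hz|Hz]] Hn]; auto. congruence.
    + intros Hz. split; [tauto|]. intros ->.
      apply NoDup_remove_2 in Nl. rewrite in_app_iff in Nl. tauto.
Qed.

Lemma degree_automorphism (f g : V -> V) (gf : forall v, g (f v) = v) (fg : forall v, f (g v) = v)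
  (fE : forall v w, E v w <-> E (f v) (f w)) x d : degree E x d -> degree E (f x) d.
Proof.
  intros (l & Nl & HL & Hl). exists (map f l). split; [|split].
  - apply NoDup_map_NoDup_ForallPairs; auto. intros a b _ _ Hab. now rewrite <- (gf a), Hab.
  - now rewrite length_map.
  - intros y. rewrite <- (fg y), <- fE, Hl, in_map_iff. split.
    + intros H. eauto.
    + intros (z & Hz & Hin). apply (f_equal g) in Hz. rewrite !gf in Hz. congruence.
Qed.

End Degrees.

Lemma cover_degree A V (E : V -> V -> Prop) p (C : covering A E p) v d :
  degree A (p v) d -> degree E v d.
Proof.
  intros (l & Nl & <- & Hl).
  assert (H : exists l', map p l' = l /\ forall w, In w l' -> E v w).
  { assert (Hin : forall b, In b l -> A (p v) b) by (intros; now apply Hl).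
    clear Nl Hl. induction l as [|b l IH].
    - exists []. simpl; tauto.
    - destruct IH as (l' & H1 & H2); [simpl in Hin; auto|].
      destruct (cov_lift C v b) as (w & Hw & Hb); [simpl in Hin; auto|].
      exists (w :: l'). simpl. split; [congruence|]. intros w' [<-|]; auto. }
  destruct H as (l' & <- & H). exists l'. split; [|split].
  - eapply NoDup_map_inv; eauto.
  - now rewrite length_map.
  - intros w. split; [|auto]. intros Hw.
    destruct (proj1 (in_map_iff p l' (p w))) as (w' & Hp & Hw').
    + apply Hl. now apply (cov_adj C).
    + rewrite (cov_inj C v w w'); auto.
Qed.

Section Join.
Variables (V : Type) (E : V -> V -> Prop).

Lemma nbwalk_join l : forall l' v, nbwalk E (v :: l) -> nbwalk E (last l v :: l') ->
  (forall w w', In w (v :: l) -> In w' l' -> w <> w') -> nbwalk E (v :: l ++ l').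
Proof.
  induction l as [|a l IH]; intros l' v W W' H; [exact W'|].
  rewrite last_cons_default in W'.
  assert (Hr : nbwalk E (a :: l ++ l')).
  { apply IH; auto.
    - exact (nbwalk_tail _ _ W).
    - intros w w' Hw. apply H. right; exact Hw. }
  destruct W as (Hva & Hn & _). split; [exact Hva|]. split; [|exact Hr].
  destruct l as [|b l]; [|exact Hn]. cbn [app]. destruct l' as [|b l']; [exact I|].
  apply H; simpl; auto.
Qed.

Lemma nbwalk_prefix l : forall l', nbwalk E (l ++ l') -> nbwalk E l.
Proof.
  induction l as [|a l IH]; intros l' H; [exact I|].
  destruct l as [|b l]; [exact I|]. destruct H as (H1 & H2 & H3).
  split; [exact H1|]. split; [|exact (IH l' H3)].
  destruct l; [exact I|exact H2].
Qed.

Lemma nbwalk_suffix l : forall l', nbwalk E (l ++ l') -> nbwalk E l'.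
Proof.
  induction l as [|a l IH]; intros l' H; [exact H|]. apply IH. exact (nbwalk_tail _ _ H).
Qed.

Lemma nbwalk_last_edge l : forall v w, nbwalk E (v :: l ++ [w]) -> E (last l v) w.
Proof.
  induction l as [|a l IH]; intros v w H.
  - simpl in *; tauto.
  - rewrite last_cons_default. apply IH. exact (nbwalk_tail _ _ H).
Qed.

Lemma nbwalk_map (f : V -> V) (fE : forall v w, E v w -> E (f v) (f w))
  (finj : forall v w, f v = f w -> v = w) l : nbwalk E l -> nbwalk E (map f l).
Proof.
  induction l as [|a l IH]; [auto|]. destruct l as [|b l]; [simpl; auto|].
  intros (H1 & H2 & H3). split; [now apply fE|]. split; [|exact (IH H3)].
  destruct l; simpl; auto.
Qed.

Lemma last_map (f : V -> V) l v : last (map f l) (f v) = f (last l v).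
Proof.
  revert v; induction l as [|a l IH]; intros v; [reflexivity|].
  cbn [map]. rewrite !last_cons_default. apply IH.
Qed.

End Join.

(** * The cover with one edge removed *)

Section Assembly.
Variables (h M r : nat).
Hypothesis Hh : 3 <= h.
Hypothesis HM : M = heap_start h + 1.
Variables (V : Type) (E : V -> V -> Prop) (p : V -> nat).
Hypothesis C : covering (heap_adj M) E p.
Hypothesis Hp : forall v, p v <= 4 * M.
Hypothesis Vfin : finite_type V.
Hypothesis Esym : forall v w, E v w -> E w v.
Hypothesis Econn : forall v w, clos_refl_trans V E v w.
Hypothesis G : girth_gt E r.
Hypothesis Hr : 4 * h + 10 <= r.
Variables (x y : V).
Hypothesis Hx : p x = M.
Hypothesis Hy : p y = M + 1.
Hypothesis Hxy : E x y.

Lemma M_ge : 6 <= M.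
Proof. exact (M_large (Nat.lt_le_incl 2 h Hh) HM). Qed.

Lemma E_irrefl v : ~ E v v.
Proof.
  intros H. apply (cov_adj C) in H. pose proof M_ge. unfold heap_adj in H. lia.
Qed.

Lemma degree_E_root v : p v = 0 -> degree E v 4.
Proof.
  intros H. apply (cover_degree C). rewrite H. apply heap_degree_root. pose proof M_ge. lia.
Qed.

Lemma degree_E_other v : p v <> 0 -> degree E v 5.
Proof.
  intros H. apply (cover_degree C). pose proof M_ge. specialize (Hp v).
  apply heap_degree; lia.
Qed.

(** The removed edge joins two lifted leaves: it is far from the roots, its ends lie in different
    fibres and so cannot be swapped, and its image lies on a triangle of the base. *)
Definition cut (v w : V) : Prop := E v w /\ ~ (v = x /\ w = y) /\ ~ (v = y /\ w = x).

Lemma cut_sym v w : cut v w -> cut w v.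
Proof. unfold cut. intuition. Qed.

Lemma cut_E v w : cut v w -> E v w.
Proof. unfold cut. tauto. Qed.

Lemma x_neq_y : x <> y.
Proof. intros e. rewrite e in Hx. lia. Qed.

Lemma degree_cut_endpoint v : v = x \/ v = y -> degree cut v 4.
Proof.
  pose proof M_ge. pose proof x_neq_y.
  intros [-> | ->].
  - apply degree_remove with (E := E) (y := y); auto.
    + apply degree_E_other. lia.
    + intros z. unfold cut. intuition congruence.
  - apply degree_remove with (E := E) (y := x); auto.
    + apply degree_E_other. lia.
    + intros z. unfold cut. intuition congruence.
Qed.

Lemma degree_cut_other v d : v <> x -> v <> y -> degree E v d -> degree cut v d.
Proof.
  intros H1 H2 (l & Nl & HL & Hl). exists l. split; [|split]; auto.
  intros z. rewrite <- Hl. unfold cut. intuition.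
Qed.

Lemma degree_cut v : degree cut v 4 \/ degree cut v 5.
Proof.
  destruct (classic (v = x \/ v = y)) as [H|H].
  - left. now apply degree_cut_endpoint.
  - destruct (Nat.eq_dec (p v) 0).
    + left. apply degree_cut_other; [tauto|tauto|now apply degree_E_root].
    + right. apply degree_cut_other; [tauto|tauto|now apply degree_E_other].
Qed.

Lemma degree_cut_4 v : degree cut v 4 <-> p v = 0 \/ v = x \/ v = y.
Proof.
  split.
  - intros H. destruct (classic (v = x \/ v = y)) as [H'|H']; [auto|left].
    destruct (Nat.eq_dec (p v) 0) as [|n]; [auto|exfalso].
    apply degree_E_other in n. apply degree_cut_other in n; [|tauto|tauto].
    generalize (degree_unique H n). lia.
  - intros H. destruct (classic (v = x \/ v = y)) as [H'|H'].
    + now apply degree_cut_endpoint.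
    + apply degree_cut_other; [tauto|tauto|]. apply degree_E_root. tauto.
Qed.

Lemma girth_cut : girth_gt cut r.
Proof.
  intros v l W. apply G. eapply nbwalk_mono; [|exact W]. exact cut_E.
Qed.

Lemma nbwalk_cut_E l : nbwalk cut l -> nbwalk E l.
Proof. apply nbwalk_mono, cut_E. Qed.

(** Both ends of the removed edge lie over leaves, but every step of this walk enters an internal
    vertex. *)
Lemma nbwalk_internal l : forall v, (forall w, In w l -> p w < M) ->
  nbwalk E (v :: l) -> nbwalk cut (v :: l).
Proof.
  induction l as [|a l IH]; intros v H W; [easy|].
  destruct W as (H1 & H2 & H3). split; [|split].
  - assert (p a < M) by (apply H; simpl; auto).
    unfold cut. repeat split; auto; intros [_ ->]; lia.
  - exact H2.
  - apply IH; [|exact H3]. intros w Hw; apply H; simpl; auto.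
Qed.

(** The vertex over the root that is reached from [v] by climbing to parents; [h + 1] is the depth
    of the deepest leaves. *)
Definition owner (v d : V) : Prop :=
  exists l, nbwalk E (v :: l) /\ last l v = d /\ p d = 0 /\ length l <= h + 1 /\
            forall w, In w l -> p w < M.

Lemma owner_exists v : exists d, owner v d.
Proof.
  assert (H : forall k v, p v < heap_start k -> exists l, nbwalk E (v :: l) /\
     p (last l v) = 0 /\ length l < k /\ forall w, In w l -> p w < M /\ p w < p v).
  { clear v. induction k as [|k IH]; intros v Hv; [simpl in Hv; lia|].
    destruct (Nat.eq_dec (p v) 0) as [H0|H0].
    - exists []. simpl. repeat split; auto; try lia; tauto.
    - destruct (heap_parent (i := p v)) as [q Hq]; [lia|].
      assert (Hpv := Hp v).
      destruct (cov_lift C v q) as (u & Hu & Hpu); [unfold heap_adj; lia|].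
      destruct (IH u) as (l & W & H1 & H2 & H3); [simpl in Hv; lia|].
      exists (u :: l). rewrite last_cons_default. split; [|split; [|split]]; auto.
      + split; [auto|]. split; [|exact W]. destruct l as [|w l]; [exact I|].
        intros ->. specialize (H3 w (or_introl eq_refl)). lia.
      + simpl; lia.
      + intros w [<-|Hw]; [lia|]. specialize (H3 w Hw). lia. }
  destruct (H (h + 2) v) as (l & W & H1 & H2 & H3).
  - specialize (Hp v). pose proof M_ge. replace (h + 2) with (S (S h)) by lia. simpl. lia.
  - exists (last l v), l. repeat split; auto; try lia. intros w Hw. now apply H3.
Qed.

(* Otherwise the two ways of reaching the common owner from [v] would differ in their first step. *)
Lemma owner_neq v l d d' : nbwalk E (v :: l) -> l <> [] -> length l <= r - 2 * (h + 1) ->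
  (forall w, In w (v :: l) -> M <= p w) -> owner v d -> owner (last l v) d' -> d <> d'.
Proof.
  intros W Hl HL Hleaf (l1 & W1 & <- & _ & L1 & I1) (l2 & W2 & HE & _ & L2 & I2) He.
  assert (e : l1 = l ++ l2).
  { apply (nbwalk_unique Esym G) with (x := v); auto.
    - apply nbwalk_join; auto. intros w w' Hw Hw' ->.
      specialize (Hleaf _ Hw). specialize (I2 _ Hw'). lia.
    - rewrite He, <- HE. destruct (exists_last Hl) as (m & b & ->).
      rewrite <- app_assoc. cbn [app]. now rewrite !last_app_cons.
    - rewrite length_app. lia. }
  destruct l as [|a l]; [easy|].
  assert (p a < M) by (apply I1; rewrite e; simpl; auto).
  assert (M <= p a) by (apply Hleaf; simpl; auto). lia.
Qed.

(** Following the lifted circle in one direction never turns back, since the circle has more than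
    two vertices. The first edge is given so that the induction can check the turn after it. *)
Lemma circle_walk k : forall u v, E u v -> M <= p u -> M <= p v ->
  p v = (if p u =? 4 * M then M else p u + 1) ->
  exists l, length l = k /\ nbwalk E (u :: v :: l) /\ forall w, In w (u :: v :: l) -> M <= p w.
Proof.
  pose proof M_ge.
  induction k as [|k IH]; intros u v Huv Hu Hv Huv'.
  - exists []. repeat split; auto. intros w [<-|[<-|[]]]; auto.
  - assert (Hpu := Hp u). assert (Hpv := Hp v).
    destruct (cov_lift C v (if p v =? 4 * M then M else p v + 1)) as (w & Hw & Hpw).
    { unfold heap_adj. destruct (Nat.eqb_spec (p v) (4 * M)); lia. }
    destruct (IH v w) as (l & L & W & I); auto.
    { destruct (p v =? 4 * M); lia. }
    exists (w :: l). split; [simpl; auto|]. split.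
    + split; [auto|]. split; [|exact W]. intros ->.
      destruct (Nat.eqb_spec (p w) (4 * M)), (Nat.eqb_spec (p v) (4 * M)); lia.
    + intros a [<-|Ha]; auto.
Qed.

(** The leaves along a lifted circle have pairwise distinct owners, as long as the girth exceeds the
    stretch between them plus two climbs. *)
Lemma many_roots k : k <= r - 2 * (h + 1) ->
  exists l, NoDup l /\ length l = k /\ forall d, In d l -> p d = 0.
Proof.
  pose proof M_ge. intros Hk.
  destruct (circle_walk k (u := x) (v := y)) as (l & L & W & I); auto; try lia.
  { rewrite Hx, Hy. destruct (Nat.eqb_spec M (4 * M)); lia. }
  apply nbwalk_tail in W. apply nbwalk_tail in W.
  assert (I' : forall w, In w l -> M <= p w) by (intros; apply I; simpl; auto). clear I.
  assert (H' : exists ds, NoDup ds /\ length ds = length l /\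
                 forall d, In d ds -> p d = 0 /\ exists a, In a l /\ owner a d).
  { rewrite <- L in Hk. clear L. induction l as [|a l IH].
    - exists []. simpl. split; [constructor|]. tauto.
    - destruct IH as (ds & N & L & H1).
      + simpl in Hk; lia.
      + exact (nbwalk_tail _ _ W).
      + intros; apply I'; simpl; auto.
      + destruct (owner_exists a) as [d Hd]. exists (d :: ds). split; [|split].
        * constructor; auto. intros Hin. destruct (H1 d Hin) as (_ & b & Hb & Hbd).
          destruct (in_split b l Hb) as (l1 & l2 & ->).
          apply (@owner_neq a (l1 ++ [b]) d d); auto.
          -- apply nbwalk_prefix with (l' := l2).
             change (nbwalk E (a :: (l1 ++ [b]) ++ l2)). now rewrite <- app_assoc.
          -- intros e. now apply app_eq_nil in e.
          -- rewrite !length_app in *. simpl in *. rewrite length_app in Hk. simpl in Hk. lia.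
          -- intros w Hw. apply I'. simpl in *. rewrite in_app_iff in *. simpl in *. tauto.
          -- now rewrite last_app_cons.
        * simpl; auto.
        * intros d' [<-|Hd'].
          -- split; [|exists a; simpl; auto]. destruct Hd; tauto.
          -- destruct (H1 d' Hd') as (H2 & b & Hb & Hbd). split; auto.
             exists b; simpl; auto. }
  destruct H' as (ds & N & L' & H1). exists ds. split; [auto|]. split; [lia|].
  intros d Hd. now apply H1.
Qed.

(** From a vertex of depth less than [h] there are only heap edges, so one step adds at most one to
    the depth. *)
Lemma walk_depth l : forall k v, nbwalk E (v :: l) -> p v < heap_start k ->
  k + length l <= h + 1 -> p (last l v) < heap_start (k + length l).
Proof.
  induction l as [|a l IH]; intros k v W Hv Hk.
  - simpl. now rewrite Nat.add_0_r.
  - rewrite last_cons_default. simpl length in *.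
    replace (k + S (length l)) with (S k + length l) by lia.
    apply IH; [exact (nbwalk_tail _ _ W)| |lia].
    assert (heap_start k <= heap_start h) by (apply heap_start_le; lia).
    destruct W as (Hva & _). apply (cov_adj C) in Hva. unfold heap_adj in Hva. simpl. lia.
Qed.

Lemma root_leaf_far l v : nbwalk E (v :: l) -> p v = 0 -> M <= p (last l v) -> h <= length l.
Proof.
  intros W Hv HL. destruct (Nat.le_gt_cases h (length l)) as [|H]; [auto|exfalso].
  assert (Hd := @walk_depth l 1 v W). simpl heap_start in Hd at 1.
  specialize (Hd ltac:(lia) ltac:(lia)).
  assert (heap_start (1 + length l) <= heap_start h) by (apply heap_start_le; lia). lia.
Qed.

(** After a step to a child, a step to a smaller index would lead to the parent, and its lift is
    unique: that would be backtracking. *)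
Lemma internal_walk_increasing l : forall u v, nbwalk E (u :: v :: l) -> p u < p v ->
  (forall w, In w (v :: l) -> p w < M) -> p u < p (last l v).
Proof.
  induction l as [|a l IH]; intros u v W Huv I; [exact Huv|].
  rewrite last_cons_default.
  assert (Iv : p v < M) by (apply I; simpl; auto).
  assert (Ia : p a < M) by (apply I; simpl; auto).
  destruct W as (Euv & Hua & W').
  assert (Eva : E v a) by (simpl in W'; tauto).
  assert (Hva : p v < p a).
  { assert (A1 := cov_adj C _ _ Euv). assert (A2 := cov_adj C _ _ Eva).
    destruct (Nat.lt_ge_cases (p v) (p a)) as [|Hle]; [auto|exfalso].
    apply Hua. apply (cov_inj C v); auto. unfold heap_adj in *. lia. }
  assert (p v < p (last l a)); [|lia].
  apply IH; auto. intros w Hw; apply I; simpl in *; auto.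
Qed.

(** An internal walk leaving a root only increases the index and never meets a root again. So the
    walk visits a leaf, which is at least [h] steps from either end. *)
Lemma root_root_far l v : nbwalk E (v :: l) -> l <> [] -> p v = 0 -> p (last l v) = 0 ->
  2 * h <= length l.
Proof.
  intros W Hl Hv HL.
  destruct (classic (forall w, In w l -> p w < M)) as [I|I].
  - exfalso. destruct l as [|a l]; [easy|]. rewrite last_cons_default in HL.
    assert (Hva : E v a) by (simpl in W; tauto).
    assert (p v < p a).
    { destruct (Nat.eq_dec (p a) 0) as [e|]; [|lia].
      apply (cov_adj C) in Hva. pose proof M_ge. unfold heap_adj in Hva. lia. }
    assert (p v < p (last l a)); [|lia]. apply internal_walk_increasing; auto.
  - apply not_all_ex_not in I. destruct I as [w I]. apply imply_to_and in I.
    destruct I as [Hw Hpw]. destruct (in_split w l Hw) as (l1 & l2 & ->).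
    assert (H1 : h <= length (l1 ++ [w])).
    { apply root_leaf_far with v; auto; [|rewrite last_app_cons; simpl; lia].
      apply nbwalk_prefix with (l' := l2).
      change (nbwalk E (v :: (l1 ++ [w]) ++ l2)). now rewrite <- app_assoc. }
    assert (W2 : nbwalk E (w :: l2)) by (apply (nbwalk_suffix E (v :: l1)); exact W).
    rewrite last_app_cons in HL.
    assert (H2 : h <= length l2).
    { apply (nbwalk_rev Esym) in W2.
      destruct (exists_last (l := w :: l2)) as (m & b & Hb); [easy|].
      assert (Hbl : last l2 w = b).
      { rewrite <- (last_cons_default w w l2), Hb. now rewrite last_app_cons. }
      rewrite Hb, rev_app_distr in W2. simpl in W2.
      assert (Hm : length (w :: l2) = length (m ++ [b])) by now rewrite Hb.
      rewrite length_app in Hm. simpl in Hm.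
      assert (h <= length (rev m)); [|rewrite length_rev in *; lia].
      apply root_leaf_far with b; auto; [congruence|].
      destruct m as [|c m].
      - simpl in Hb. injection Hb as -> ->. simpl in HL. lia.
      - simpl in Hb. injection Hb as <- _. simpl. rewrite last_app_cons. simpl. lia. }
    rewrite length_app in *. simpl in *. lia.
Qed.

Lemma nbwalk_reverse v l : nbwalk E (v :: l) ->
  exists l', nbwalk E (last l v :: l') /\ last l' (last l v) = v /\ length l' = length l.
Proof.
  intros W. destruct l as [|a l].
  - exists []. auto.
  - destruct (exists_last (l := a :: l)) as (m & b & Hb); [easy|].
    rewrite Hb, last_app_cons in *. cbn [last].
    exists (rev m ++ [v]). rewrite last_app_cons, !length_app, length_rev.
    split; [|auto]. apply (nbwalk_rev Esym) in W.
    replace (b :: rev m ++ [v]) with (rev (v :: m ++ [b])); [exact W|].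
    simpl. now rewrite rev_app_distr.
Qed.

(** The step into [a] uses an edge that survives the cut, so crossing the removed edge next is not a
    step back. *)
Lemma nbwalk_extend_cut l a b : (a = x /\ b = y \/ a = y /\ b = x) -> forall v,
  nbwalk cut (v :: l) -> last l v = a -> nbwalk E (v :: l ++ [b]).
Proof.
  intros Hab. induction l as [|c l IH]; intros v W HL.
  - simpl in *. subst v. repeat split. destruct Hab as [[-> ->]|[-> ->]]; auto.
  - rewrite last_cons_default in HL. cbn [app].
    destruct W as (H1 & H2 & H3). split; [now apply cut_E|]. split; [|now apply IH].
    destruct l as [|d l]; [|exact H2]. simpl in *. intros ->. subst c.
    destruct H1 as (_ & H4 & H5). destruct Hab as [[-> ->]|[-> ->]]; tauto.
Qed.

(** Crossing the removed edge after reaching [x] gives a second short walk to [y]. By uniqueness the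
    two agree, so the walk in the cut graph would end with the removed edge. *)
Lemma endpoints_not_both_near v l1 l2 : nbwalk cut (v :: l1) -> nbwalk cut (v :: l2) ->
  last l1 v = x -> last l2 v = y -> S (length l1) + length l2 <= r -> False.
Proof.
  intros W1 W2 H1 H2 HL.
  assert (e : l1 ++ [y] = l2).
  { apply (nbwalk_unique Esym G) with (x := v).
    - apply nbwalk_extend_cut with (a := x); auto.
    - now apply nbwalk_cut_E.
    - now rewrite last_app_cons.
    - rewrite length_app. simpl. lia. }
  subst l2. apply nbwalk_last_edge in W2. rewrite H1 in W2. unfold cut in W2. tauto.
Qed.

(** Two roots are far apart, a root is far from the ends because these lie over leaves, and the two
    ends are far apart because a short walk between them would close up with the removed edge. *)
Lemma cut_separated l v : nbwalk cut (v :: l) -> v <> last l v ->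
  degree cut v 4 -> degree cut (last l v) 4 -> h <= length l.
Proof.
  intros W Hne Hv HL. apply degree_cut_4 in Hv, HL.
  destruct (Nat.le_gt_cases h (length l)) as [|Hlt]; [auto|exfalso].
  assert (WE := nbwalk_cut_E _ W).
  assert (Hl : l <> []) by (intros ->; now apply Hne).
  destruct Hv as [Hv|Hv], HL as [HL|HL].
  - generalize (root_root_far WE Hl Hv HL). lia.
  - assert (h <= length l); [|lia]. apply root_leaf_far with v; auto.
    destruct HL as [-> | ->]; lia.
  - destruct (nbwalk_reverse _ _ WE) as (l' & W' & H1 & H2).
    assert (h <= length l'); [|lia]. apply (root_leaf_far _ W' HL). rewrite H1.
    destruct Hv as [-> | ->]; lia.
  - destruct Hv as [-> | ->], HL as [HL|HL]; try congruence.
    + apply (@endpoints_not_both_near x [] l); simpl; auto. lia.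
    + apply (@endpoints_not_both_near y l []); simpl; auto. lia.
Qed.

(** One root is found by climbing from [a], the other by moving to the leaf [z] first. For an end of
    the removed edge this is the feature that no root shares. *)
Lemma two_near_roots a z : M <= p a -> M <= p z -> cut a z ->
  exists l1 l2, nbwalk cut (a :: l1) /\ nbwalk cut (a :: l2) /\ last l1 a <> last l2 a /\
    p (last l1 a) = 0 /\ p (last l2 a) = 0 /\ length l1 <= h + 2 /\ length l2 <= h + 2.
Proof.
  intros Ha Hz Haz.
  destruct (owner_exists a) as [d1 O1], (owner_exists z) as [d2 O2].
  assert (Hd : d1 <> d2).
  { apply (@owner_neq a [z]); auto.
    - repeat split. now apply cut_E.
    - easy.
    - simpl. lia.
    - intros w [<-|[<-|[]]]; auto. }
  destruct O1 as (l1 & W1 & <- & H1 & L1 & I1), O2 as (l2 & W2 & <- & H2 & L2 & I2).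
  exists l1, (z :: l2). rewrite last_cons_default. split; [now apply nbwalk_internal|].
  split; [|repeat split; auto; simpl; lia].
  split; [auto|]. split; [|now apply nbwalk_internal].
  destruct l2 as [|w l2]; [exact I|]. intros ->.
  specialize (I2 w (or_introl eq_refl)). lia.
Qed.

Lemma endpoint_near a : a = x \/ a = y -> exists z, M <= p z /\ cut a z.
Proof.
  pose proof M_ge. intros [->| ->].
  - destruct (cov_lift C x (4 * M)) as (z & Hz & Hpz); [unfold heap_adj; lia|].
    exists z. split; [lia|]. split; [auto|]. split; intros [e1 e2]; subst; lia.
  - destruct (cov_lift C y (M + 2)) as (z & Hz & Hpz); [unfold heap_adj; lia|].
    exists z. split; [lia|]. split; [auto|]. split; intros [e1 e2]; subst; lia.
Qed.

Section Rigid.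
Variables (f g : V -> V).
Hypothesis gf : forall v, g (f v) = v.
Hypothesis fg : forall v, f (g v) = v.
Hypothesis fcut : forall v w, cut v w <-> cut (f v) (f w).

Lemma f_inj v w : f v = f w -> v = w.
Proof. intros H. now rewrite <- (gf v), H. Qed.

(** If an end went to a root, that root would have two further vertices of degree 4 within [h + 2]
    steps. They are not roots, since [h + 2 < 2 * h] for [3 <= h]; so they are [x] and [y], which
    cannot both be near. *)
Lemma f_endpoint a : a = x \/ a = y -> f a = x \/ f a = y.
Proof.
  pose proof M_ge. intros Ha.
  assert (Hfa : degree cut (f a) 4).
  { apply (degree_automorphism f g gf fg fcut). now apply degree_cut_4; right. }
  apply degree_cut_4 in Hfa. destruct Hfa as [H0|]; [exfalso|auto].
  destruct (endpoint_near Ha) as (z & Hz & Haz).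
  assert (Hpa : M <= p a) by (destruct Ha as [-> | ->]; lia).
  destruct (two_near_roots Hpa Hz Haz) as (l1 & l2 & W1 & W2 & Hne & R1 & R2 & L1 & L2).
  assert (Hend : forall l, nbwalk cut (a :: l) -> p (last l a) = 0 -> length l <= h + 2 ->
    nbwalk cut (f a :: map f l) /\ (last (map f l) (f a) = x \/ last (map f l) (f a) = y)).
  { intros l W R L.
    assert (W' : nbwalk cut (f a :: map f l)).
    { apply (@nbwalk_map V cut f) with (l := a :: l); auto.
      - intros v w. apply fcut.
      - exact f_inj. }
    split; [exact W'|].
    assert (HD : degree cut (last (map f l) (f a)) 4).
    { rewrite last_map. apply (degree_automorphism f g gf fg fcut). apply degree_cut_4; auto. }
    apply degree_cut_4 in HD. destruct HD as [HD|HD]; [exfalso|exact HD].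
    assert (2 * h <= length (map f l)); [|rewrite length_map in *; lia].
    apply root_root_far with (f a); auto.
    - now apply nbwalk_cut_E.
    - destruct l; [|easy]. simpl in R. lia. }
  destruct (Hend l1) as [W1' E1], (Hend l2) as [W2' E2]; auto.
  assert (Hne' : last (map f l1) (f a) <> last (map f l2) (f a)).
  { rewrite !last_map. intros e. now apply Hne, f_inj. }
  destruct E1 as [E1|E1], E2 as [E2|E2]; try congruence.
  - apply (@endpoints_not_both_near _ _ _ W1' W2' E1 E2). rewrite !length_map. lia.
  - apply (@endpoints_not_both_near _ _ _ W2' W1' E2 E1). rewrite !length_map. lia.
Qed.

(* An automorphism of the cut graph permutes the two ends of the removed edge, hence extends to the cover. *)
Lemma cut_rigid v : f v = v.
Proof.
  pose proof x_neq_y as Nxy.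
  assert (Fxy : f x = x /\ f y = y \/ f x = y /\ f y = x).
  { destruct (@f_endpoint x) as [e1|e1]; auto; destruct (@f_endpoint y) as [e2|e2]; auto;
      exfalso; apply Nxy, f_inj; congruence. }
  assert (fE : forall v w, E v w <-> E (f v) (f w)).
  { intros u w. destruct (classic (cut u w)) as [Hc|Hc].
    - assert (Hc' := proj1 (fcut u w) Hc). apply cut_E in Hc, Hc'. tauto.
    - assert (Hc' : ~ cut (f u) (f w)) by now rewrite <- fcut.
      split; intros Huw.
      + assert (e : u = x /\ w = y \/ u = y /\ w = x) by (unfold cut in Hc; tauto).
        destruct e as [[-> ->]|[-> ->]], Fxy as [[-> ->]|[-> ->]]; auto.
      + assert (e : f u = x /\ f w = y \/ f u = y /\ f w = x) by (unfold cut in Hc'; tauto).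
        destruct Fxy as [[F1 F2]|[F1 F2]], e as [[e1 e2]|[e1 e2]];
          first [rewrite <- F1 in e1; rewrite <- F2 in e2 | rewrite <- F2 in e1; rewrite <- F1 in e2];
          apply f_inj in e1, e2; subst; auto. }
  assert (Hroot : forall v, degree E v 4 <-> p v = 0).
  { intros u. split; [|apply degree_E_root]. intros H.
    destruct (Nat.eq_dec (p u) 0) as [|n]; [auto|].
    generalize (degree_unique H (degree_E_other n)). lia. }
  assert (f0 : forall v, p v = 0 <-> p (f v) = 0).
  { intros u. rewrite <- !Hroot. split.
    - apply (degree_automorphism f g gf fg fE).
    - intros H. rewrite <- (gf u). apply (degree_automorphism g f fg gf); auto.
      intros a b. rewrite (fE (g a) (g b)), !fg. tauto. }
  assert (Hcls := automorphism_preserves_class (h := h) (M := M) ltac:(lia) HM C Hp f g fg fE f0).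
  (* The swap is excluded because [x] and [y] lie over [M] and [M + 1], and [f] preserves fibres. *)
  assert (Fx : f x = x).
  { destruct Fxy as [[F1 _]|[F1 _]]; auto. specialize (Hcls x). rewrite F1 in Hcls. lia. }
  assert (Hv := Econn x v). apply clos_rt_rtn1 in Hv.
  induction Hv as [|u w Huw _ IH]; [exact Fx|].
  apply (cov_inj C u); auto. rewrite <- IH at 1. exact (proj1 (fE u w) Huw).
Qed.

End Rigid.

(* Lifting the triangle [M, M + 1, M + 2] gives an injection of the fibre over [M]; were [x] not joined to [y] after the cut, it would map that fibre's part of the component of [y] together with [x] into that part. *)
Lemma cut_joins_endpoints : clos_refl_trans V cut y x.
Proof.
  pose proof M_ge.
  apply NNPP. intros HK. set (K := clos_refl_trans V cut y) in *.
  set (tau := fun v u => exists w1 w2, E v w1 /\ p w1 = M + 1 /\ E w1 w2 /\ p w2 = M + 2 /\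
                           E w2 u /\ p u = M).
  assert (Htau : forall v, exists u, p v = M -> tau v u).
  { intros v. destruct (Nat.eq_dec (p v) M) as [Hv|Hv]; [|exists v; tauto].
    destruct (cov_lift C v (M + 1)) as (w1 & H1 & P1); [unfold heap_adj; lia|].
    destruct (cov_lift C w1 (M + 2)) as (w2 & H2 & P2); [unfold heap_adj; lia|].
    destruct (cov_lift C w2 M) as (u & H3 & P3); [unfold heap_adj; lia|].
    exists u. intros _. exists w1, w2. auto 6. }
  set (T := fun v => proj1_sig (constructive_indefinite_description _ (Htau v))).
  assert (HT : forall v, p v = M -> tau v (T v)).
  { intros v. unfold T. now destruct (constructive_indefinite_description _ (Htau v)). }
  assert (Tinj : forall v v', p v = M -> p v' = M -> T v = T v' -> v = v').
  { intros v v' Hv Hv' e. destruct (HT v Hv) as (w1 & w2 & A1 & P1 & A2 & P2 & A3 & P3).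
    destruct (HT v' Hv') as (w1' & w2' & A1' & P1' & A2' & P2' & A3' & P3').
    rewrite <- e in *.
    assert (w2 = w2') by (apply (cov_inj C (T v)); auto; congruence). subst w2'.
    assert (w1 = w1') by (apply (cov_inj C w2); auto; congruence). subst w1'.
    apply (cov_inj C w1); auto; congruence. }
  assert (Tcut : forall v w1 w2, K w1 -> p w1 = M + 1 -> E w1 w2 -> p w2 = M + 2 ->
            E w2 v -> p v = M -> K v).
  { intros v w1 w2 HK1 P1 A2 P2 A3 P3. eapply rt_trans; [exact HK1|].
    apply rt_trans with w2; apply rt_step; (split; [auto|]);
      split; intros [e1 e2]; subst; lia. }
  assert (TK : forall v, p v = M -> K v \/ v = x -> K (T v)).
  { intros v Hv Hor. destruct (HT v Hv) as (w1 & w2 & A1 & P1 & A2 & P2 & A3 & P3).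
    apply (Tcut (T v) w1 w2); auto. destruct Hor as [Hk| ->].
    - eapply rt_trans; [exact Hk|]. apply rt_step. split; [auto|]. split; intros [e1 e2].
      + subst. now apply HK.
      + subst. lia.
    - rewrite (cov_inj C x w1 y); auto; [apply rt_refl|lia]. }
  destruct Vfin as [all Hall].
  set (sel := fun v => if excluded_middle_informative (p v = M /\ K v) then true else false).
  assert (dec : forall a b : V, {a = b} + {a <> b}) by (intros; apply excluded_middle_informative).
  set (l := filter sel (nodup dec all)).
  assert (Hl : forall v, In v l <-> p v = M /\ K v).
  { intros v. unfold l. rewrite filter_In, nodup_In. unfold sel.
    destruct (excluded_middle_informative (p v = M /\ K v)) as [H1|H1].
    - split; [tauto|]. intros _. split; [apply Hall|reflexivity].
    - split; [|tauto]. intros [_ e]. discriminate e. }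
  assert (Nl : NoDup (x :: l)).
  { constructor; [rewrite Hl; tauto|]. apply NoDup_filter, NoDup_nodup. }
  assert (N : NoDup (map T (x :: l))).
  { apply NoDup_map_NoDup_ForallPairs; [|exact Nl]. intros a b Ha Hb. apply Tinj.
    - destruct Ha as [<-|Ha]; [auto|]. now apply Hl in Ha.
    - destruct Hb as [<-|Hb]; [auto|]. now apply Hl in Hb. }
  assert (Hlen : length (map T (x :: l)) <= length l).
  { apply NoDup_incl_length; [exact N|]. intros u Hu. apply in_map_iff in Hu.
    destruct Hu as (v & <- & Hv). apply Hl.
    assert (Hv' : p v = M /\ (K v \/ v = x)).
    { destruct Hv as [<-|Hv]; [auto|]. apply Hl in Hv. tauto. }
    destruct (HT v (proj1 Hv')) as (w1 & w2 & H'). split; [tauto|]. apply TK; tauto. }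
  rewrite length_map in Hlen. simpl in Hlen. lia.
Qed.

Lemma cut_connected v w : clos_refl_trans V cut v w.
Proof.
  assert (H := cut_joins_endpoints).
  assert (H' := clos_rt_sym cut_sym H).
  assert (Hvw := Econn v w). induction Hvw as [v w Hvw|v|u v w _ IH1 _ IH2].
  - destruct (classic (cut v w)) as [Hc|Hc]; [now apply rt_step|].
    assert (e : v = x /\ w = y \/ v = y /\ w = x) by (unfold cut in Hc; tauto).
    destruct e as [[-> ->]|[-> ->]]; auto.
  - apply rt_refl.
  - eapply rt_trans; eauto.
Qed.

End Assembly.

Theorem rigid_graph_exists (n : nat) :
  exists (V : Type) (E : V -> V -> Prop),
    finite_type V /\ inhabited V /\ (forall v w, E v w -> E w v) /\ (forall v, ~ E v v) /\
    (forall v w, clos_refl_trans V E v w) /\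
    (forall v, degree E v 4 \/ degree E v 5) /\ girth_gt E n /\
    (forall v l, nbwalk E (v :: l) -> v <> last l v ->
       degree E v 4 -> degree E (last l v) 4 -> n < length l) /\
    (exists l, NoDup l /\ length l = n /\ forall v, In v l -> degree E v 4) /\
    (forall f g : V -> V, (forall v, g (f v) = v) -> (forall v, f (g v) = v) ->
       (forall v w, E v w <-> E (f v) (f w)) -> forall v, f v = v).
Proof.
  (* The depth exceeds the required separation [n], and it is at least 3, as recognising the ends
     demands. *)
  assert (Hh : exists h, h = n + 3) by eauto. destruct Hh as [h Hn].
  assert (HM : exists M, M = heap_start h + 1) by eauto. destruct HM as [M HM].
  (* Two uses of the girth must be covered: two walks of [h + 2] steps plus the removed edge, and
     fewer than [n] steps along leaves plus two climbs of [h + 1]. *)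
  assert (Hr : exists r, r = 4 * h + 10) by eauto. destruct Hr as [r Hr'].
  assert (Hh : 3 <= h) by lia.
  assert (Hr : 4 * h + 10 <= r) by lia.
  assert (HM6 : 6 <= M) by (apply (@M_large h M); [lia|exact HM]).
  destruct (@covering_exists (heap_adj M) (S (4 * M)) r (@heap_adj_sym M)) with (b0 := M)
    as (V & E & p & C & Hp & Vfin & Esym & Econn & G & x & Hx).
  - unfold heap_adj. intros; lia.
  - lia.
  - assert (Hp' : forall v, p v <= 4 * M) by (intros v; specialize (Hp v); lia).
    destruct (cov_lift C x (M + 1)) as (y & Hxy & Hy); [unfold heap_adj; lia|].
    exists V, (cut E x y).
    split; [auto|]. split; [constructor; exact x|]. split; [now apply cut_sym|].
    split; [intros v Hv; apply cut_E in Hv; revert Hv; eapply (@E_irrefl h M r); eauto|].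
    split; [eapply cut_connected; eauto|].
    split; [eapply degree_cut; eauto|].
    split.
    { intros v l W HL Hln. eapply girth_cut; eauto. lia. }
    split.
    { intros v l W Hne D1 D2. assert (h <= length l) by (eapply cut_separated; eauto).
      lia. }
    split.
    { assert (Hroots : exists l, NoDup l /\ length l = n /\ forall d, In d l -> p d = 0)
        by (eapply (@many_roots h M r); eauto; lia).
      destruct Hroots as (l & N & L & H).
      exists l. split; [auto|]. split; [auto|]. intros v Hv.
      eapply degree_cut_4; eauto. }
    intros f g gf fg fE v. eapply cut_rigid; eauto.
Qed.

(** * Uniqueness of regular trees *)

Record is_tree (V : Type) (E : V -> V -> Prop) : Prop := {
  tree_sym : forall x y, E x y -> E y x;
  tree_conn : forall x y, clos_refl_trans V E x y;
  tree_acyclic : forall r, girth_gt E r }.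

(** This treats both trees at once: [d = 4] is T_R rooted at its exceptional vertex, [d = 5] is T'_R
    rooted anywhere. *)
Record rooted_tree (V : Type) (E : V -> V -> Prop) (a : V) (d : nat) : Prop := {
  rt_tree : is_tree E;
  rt_root : degree E a d;
  rt_other : forall x, x <> a -> degree E x 5 }.

(* [locate w] is the vertex with address [w] (last step first), paired with its parent. *)
Section Addresses.
Variables (V : Type) (E : V -> V -> Prop) (a : V) (d : nat).
Hypothesis T : rooted_tree E a d.

Definition is_children (v : V) (p : option V) (l : list V) : Prop :=
  NoDup l /\ (forall y, In y l <-> E v y /\ p <> Some y) /\
  length l = match p with None => d | Some _ => 4 end.

Lemma children_exist v p :
  exists l, (p = None /\ v = a \/ (exists u, p = Some u /\ E v u /\ v <> a)) -> is_children v p l.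
Proof.
  destruct (classic (p = None /\ v = a \/ (exists u, p = Some u /\ E v u /\ v <> a)))
    as [[[-> ->]|(u & -> & Hu & Hv)]|H].
  - destruct (rt_root T) as (l & N & L & Hl). exists l. intros _.
    split; [auto|]. split; [|auto]. intros y. rewrite <- Hl. intuition discriminate.
  - assert (H5 : degree (fun x y => E x y /\ y <> u) v 4).
    { apply degree_remove with (E := E) (y := u); auto; [now apply (rt_other T)|tauto]. }
    destruct H5 as (l & N & L & Hl). exists l. intros _.
    split; [auto|]. split; [|auto]. intros y. rewrite <- Hl. intuition congruence.
  - exists []. tauto.
Qed.

Definition children (v : V) (p : option V) : list V :=
  proj1_sig (constructive_indefinite_description _ (children_exist v p)).

Lemma children_spec v p :
  p = None /\ v = a \/ (exists u, p = Some u /\ E v u /\ v <> a) -> is_children v p (children v p).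
Proof. exact (proj2_sig (constructive_indefinite_description _ (children_exist v p))). Qed.

Fixpoint locate (w : list nat) : option (V * option V) :=
  match w with
  | [] => Some (a, None)
  | i :: w =>
      match locate w with
      | Some (v, p) =>
          match nth_error (children v p) i with Some u => Some (u, Some v) | None => None end
      | None => None
      end
  end.

Lemma locate_cons i w u q : locate (i :: w) = Some (u, q) ->
  exists v p, locate w = Some (v, p) /\ nth_error (children v p) i = Some u /\ q = Some v.
Proof.
  simpl. destruct (locate w) as [[v p]|]; [|discriminate].
  destruct (nth_error (children v p) i) as [u'|] eqn:Hu; [|discriminate].
  intros [= <- <-]. exists v, p. auto.
Qed.

(** Climbing back to the root is a non-backtracking walk. By acyclicity a nonempty address never
    leads to the root again, which is what makes the number of children 4. *)
Lemma locate_trace w : forall v p, locate w = Some (v, p) ->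
  (exists l, nbwalk E (v :: l) /\ last l v = a /\ length l = length w /\ p = hd_error l) /\
  is_children v p (children v p).
Proof.
  induction w as [|i w IH]; intros v p H.
  - injection H as <- <-. split; [|apply children_spec; auto].
    exists []. simpl; auto.
  - destruct (locate_cons _ _ H) as (u & q & Hu & Hi & ->).
    destruct (IH _ _ Hu) as ((l & W & HL & L & Hq) & _ & HK & _).
    apply nth_error_In, HK in Hi. destruct Hi as [Huv Hn].
    assert (W' : nbwalk E (v :: u :: l)).
    { split; [now apply (tree_sym (rt_tree T))|]. split; [|exact W].
      subst q. destruct l as [|b l]; [auto|]. simpl in Hn. congruence. }
    split.
    + exists (u :: l). rewrite last_cons_default. simpl. auto.
    + apply children_spec. right. exists u. split; [auto|]. split.
      * simpl in W'; tauto.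
      * intros ->. assert (e : u :: l = []); [|discriminate e].
        eapply (tree_acyclic (rt_tree T)); [exact W'| |].
        -- rewrite last_cons_default; auto.
        -- apply le_n.
Qed.

(** Both addresses climb to the root by the same walk, so the parents agree, and the last indices
    agree because the list of children has no repetition. *)
Lemma locate_inj w : forall w' v p p',
  locate w = Some (v, p) -> locate w' = Some (v, p') -> w = w'.
Proof.
  induction w as [|i w IH]; intros w' v p p' H H';
    destruct (proj1 (locate_trace _ H)) as (l & W & HL & L & Hp);
    destruct (proj1 (locate_trace _ H')) as (l' & W' & HL' & L' & Hp');
    assert (e : l = l') by
      (apply (nbwalk_unique (tree_sym (rt_tree T)) (tree_acyclic (rt_tree T) (r := length l + length l')))
         with (x := v); auto; congruence); subst l'.
  - destruct w'; [auto|]. simpl in *; congruence.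
  - destruct w' as [|j w']; [simpl in *; congruence|].
    destruct (locate_cons _ _ H) as (u & q & Hu & Hi & ->).
    destruct (locate_cons _ _ H') as (u' & q' & Hu' & Hj & ->).
    assert (u = u') by congruence. subst u'.
    assert (w = w') by eauto. subst w'. rewrite Hu in Hu'. injection Hu' as <-.
    f_equal. destruct (locate_trace _ Hu) as (_ & N & _).
    apply (proj1 (NoDup_nth_error (children u q)) N); [|congruence].
    apply nth_error_Some. congruence.
Qed.

Lemma locate_edge w v p v' : locate w = Some (v, p) -> E v v' ->
  exists i w' p', locate w' = Some (v', p') /\ (w' = i :: w \/ w = i :: w').
Proof.
  intros H Hv. destruct (classic (p = Some v')) as [e|e].
  - destruct w as [|i w]; [simpl in H; congruence|].
    destruct (locate_cons _ _ H) as (u & q & Hu & _ & Hp).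
    assert (u = v') by congruence. subst u. exists i, w, q. auto.
  - destruct (locate_trace _ H) as (_ & _ & HK & _).
    destruct (In_nth_error (children v p) v') as [i Hi]; [now apply HK|].
    exists i, (i :: w), (Some v). simpl. rewrite H, Hi. auto.
Qed.

Lemma locate_surj v : exists w p, locate w = Some (v, p).
Proof.
  assert (H := tree_conn (rt_tree T) a v). apply clos_rt_rtn1 in H.
  induction H as [|u v Huv _ (w & p & IH)].
  - exists [], None. reflexivity.
  - destruct (locate_edge _ IH Huv) as (i & w' & p' & H & _). eauto.
Qed.

Lemma locate_adj w v p w' v' p' : locate w = Some (v, p) -> locate w' = Some (v', p') ->
  (E v v' <-> exists i, w' = i :: w \/ w = i :: w').
Proof.
  assert (Hpc : forall i w u q v p, locate w = Some (v, p) -> locate (i :: w) = Some (u, q) -> E v u).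
  { clear. intros i w u q v p H H'. destruct (locate_cons _ _ H') as (v1 & p1 & H1 & Hi & _).
    rewrite H in H1. injection H1 as <- <-. apply nth_error_In in Hi.
    destruct (locate_trace _ H) as (_ & _ & HK & _). now apply HK in Hi. }
  intros H H'. split.
  - intros Hv. destruct (locate_edge _ H Hv) as (i & w1 & p1 & H1 & Hw).
    rewrite (locate_inj _ _ H' H1). eauto.
  - intros (i & [->| ->]).
    + eapply Hpc; eauto.
    + apply (tree_sym (rt_tree T)). eapply Hpc; eauto.
Qed.

(** Which addresses exist depends on [d] alone, so two trees with the same [d] can be matched
    address by address. *)
Lemma locate_defined i w : locate (i :: w) <> None <->
  locate w <> None /\ i < match w with [] => d | _ => 4 end.
Proof.
  assert (Hs : forall v p, locate w = Some (v, p) ->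
     length (children v p) = match w with [] => d | _ => 4 end).
  { intros v p H. destruct (locate_trace _ H) as (_ & _ & _ & ->).
    destruct w as [|j w]; [injection H as <- <-; reflexivity|].
    destruct (locate_cons _ _ H) as (u & q & _ & _ & ->). reflexivity. }
  simpl. destruct (locate w) as [[v p]|]; [|tauto].
  rewrite <- (Hs v p eq_refl), <- nth_error_Some.
  destruct (nth_error (children v p) i); intuition congruence.
Qed.

End Addresses.

Definition graph_iso (V W : Type) (E : V -> V -> Prop) (F : W -> W -> Prop)
  (f : V -> W) (g : W -> V) : Prop :=
  (forall x, g (f x) = x) /\ (forall y, f (g y) = y) /\ (forall x y, E x y <-> F (f x) (f y)).

Theorem rooted_tree_unique (V W : Type) (E : V -> V -> Prop) (F : W -> W -> Prop) a b d :
  rooted_tree E a d -> rooted_tree F b d -> exists f g, graph_iso E F f g.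
Proof.
  intros T T'.
  assert (Hdef : forall w, locate T w <> None <-> locate T' w <> None).
  { induction w as [|i w IH]; [simpl; split; discriminate|].
    rewrite !locate_defined, IH. tauto. }
  set (rho := fun x y => exists w p q, locate T w = Some (x, p) /\ locate T' w = Some (y, q)).
  assert (Hf : forall x, exists y, rho x y).
  { intros x. destruct (locate_surj T x) as (w & p & H).
    destruct (locate T' w) as [[y q]|] eqn:H'.
    - exists y, w, p, q. auto.
    - exfalso. apply (proj1 (Hdef w)); congruence. }
  assert (Hg : forall y, exists x, rho x y).
  { intros y. destruct (locate_surj T' y) as (w & p & H).
    destruct (locate T w) as [[x q]|] eqn:H'.
    - exists x, w, q, p. auto.
    - exfalso. apply (proj2 (Hdef w)); congruence. }
  assert (Hfun : forall x y y', rho x y -> rho x y' -> y = y').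
  { intros x y y' (w & p & q & H1 & H2) (w' & p' & q' & H1' & H2').
    assert (w = w') by (eapply (locate_inj T); eauto). congruence. }
  assert (Hinj : forall x x' y, rho x y -> rho x' y -> x = x').
  { intros x x' y (w & p & q & H1 & H2) (w' & p' & q' & H1' & H2').
    assert (w = w') by (eapply (locate_inj T'); eauto). congruence. }
  set (f := fun x => proj1_sig (constructive_indefinite_description _ (Hf x))).
  set (g := fun y => proj1_sig (constructive_indefinite_description _ (Hg y))).
  assert (Rf : forall x, rho x (f x)) by (intros; apply proj2_sig).
  assert (Rg : forall y, rho (g y) y) by (intros; apply proj2_sig).
  exists f, g. split; [|split].
  - intros x. eapply Hinj; [apply Rg|apply Rf].
  - intros y. eapply Hfun; [apply Rf|apply Rg].
  - intros x y. destruct (Rf x) as (w & p & q & H1 & H2), (Rf y) as (w' & p' & q' & H1' & H2').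
    rewrite (locate_adj T _ _ H1 H1'), (locate_adj T' _ _ H2 H2'). tauto.
Qed.

(** * Structures as graphs *)

Section Structures.
Variables (Sym : Type) (ar : Sym -> nat) (R : Sym).
Hypothesis HR : 2 <= ar R.

Definition edge (M : structure ar) (a b : dom M) : Prop := rel M R (a :: repeat b (ar R - 1)).

Lemma edge_tuple_inj (X : Type) (a b a' b' : X) :
  a :: repeat b (ar R - 1) = a' :: repeat b' (ar R - 1) -> a = a' /\ b = b'.
Proof.
  destruct (ar R - 1) as [|k] eqn:Hk; [lia|]. simpl. intros e. injection e. auto.
Qed.

Lemma edge_sym (M : structure ar) : is_Rgraph R M -> forall a b, edge M a b -> edge M b a.
Proof.
  intros [_ H] a b Hab. destruct (H _ Hab) as (a' & b' & _ & e & Hba).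
  apply edge_tuple_inj in e. destruct e as [-> ->]. exact Hba.
Qed.

Lemma edge_neq (M : structure ar) : is_Rgraph R M -> forall a b, edge M a b -> a <> b.
Proof.
  intros [_ H] a b Hab. destruct (H _ Hab) as (a' & b' & Hn & e & _).
  apply edge_tuple_inj in e. destruct e as [-> ->]. exact Hn.
Qed.

Lemma adj_edge (M : structure ar) : is_Rgraph R M -> forall a b, adj M a b <-> edge M a b.
Proof.
  intros HM a b. split.
  - intros (Hn & S & t & Ht & Ha & Hb).
    destruct (classic (S = R)) as [->|HS]; [|now apply HM in Ht].
    destruct (proj2 HM _ Ht) as (c & e & _ & -> & _).
    assert (He := edge_sym HM _ _ Ht).
    simpl in Ha, Hb.
    destruct Ha as [<-|Ha], Hb as [<-|Hb]; try congruence.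
    + apply repeat_spec in Hb. now subst.
    + apply repeat_spec in Ha. now subst.
    + apply repeat_spec in Ha, Hb. congruence.
  - intros H. split; [now apply (edge_neq HM)|]. exists R, (a :: repeat b (ar R - 1)).
    split; [exact H|]. split; [simpl; auto|]. right.
    destruct (ar R - 1) eqn:Hk; [lia|]. simpl; auto.
Qed.

Lemma iso_of_graph_iso (M N : structure ar) : is_Rgraph R M -> is_Rgraph R N ->
  forall f g, graph_iso (@edge M) (@edge N) f g -> iso M N.
Proof.
  intros HM HN f g (gf & fg & fE). exists f, g. split; [auto|]. split; [auto|].
  intros S t. destruct (classic (S = R)) as [->|HS].
  - split; intros Ht.
    + destruct (proj2 HM _ Ht) as (a & b & _ & -> & _). cbn [map]. rewrite map_repeat.
      now apply fE.
    + destruct (proj2 HN _ Ht) as (a & b & _ & e & _).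
      assert (et : t = g a :: repeat (g b) (ar R - 1)).
      { rewrite <- map_repeat. change (t = map g (a :: repeat b (ar R - 1))).
        rewrite <- e, map_map. rewrite (map_ext _ (fun x => x)) by auto. now rewrite map_id. }
      rewrite et. apply fE. rewrite !fg. unfold edge. now rewrite <- e.
  - split; intros Ht; exfalso; [eapply (proj1 HM)|eapply (proj1 HN)]; eauto.
Qed.

Lemma iso_sym (M N : structure ar) : iso M N -> iso N M.
Proof.
  intros (f & g & gf & fg & H). exists g, f. split; [auto|]. split; [auto|].
  intros S t. rewrite H, map_map, (map_ext _ (fun x => x)) by auto. now rewrite map_id.
Qed.

(** * Graphs as structures *)

Section GraphStructure.
Variables (V : Type) (E : V -> V -> Prop).

Definition graph_rel (S : Sym) (t : list V) : Prop :=
  S = R /\ exists a b, t = a :: repeat b (ar R - 1) /\ E a b.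

Lemma graph_rel_ar S t : graph_rel S t -> length t = ar S.
Proof.
  intros (-> & a & b & -> & _). simpl. rewrite repeat_length. lia.
Qed.

Definition graph_structure : structure ar := Struct ar graph_rel graph_rel_ar.

Lemma graph_edge a b : @edge graph_structure a b <-> E a b.
Proof.
  split.
  - intros (_ & a' & b' & e & H). apply edge_tuple_inj in e. now destruct e as [-> ->].
  - intros H. split; [reflexivity|]. exists a, b. auto.
Qed.

Lemma graph_edge_eq : @edge graph_structure = E.
Proof.
  apply functional_extensionality; intros x. apply functional_extensionality; intros y.
  apply propositional_extensionality. apply graph_edge.
Qed.

Hypothesis Esym : forall x y, E x y -> E y x.
Hypothesis Eirr : forall x, ~ E x x.

Lemma graph_structure_Rgraph : is_Rgraph R graph_structure.
Proof.
  split.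
  - intros S t HS [e _]. auto.
  - intros t (_ & a & b & -> & H). exists a, b. split; [intros ->; exact (Eirr H)|].
    split; [reflexivity|]. apply graph_edge. auto.
Qed.

Lemma graph_structure_rigid :
  (forall f g : V -> V, (forall v, g (f v) = v) -> (forall v, f (g v) = v) ->
     (forall v w, E v w <-> E (f v) (f w)) -> forall v, f v = v) ->
  rigid graph_structure.
Proof.
  intros H f ((g & gf & fg) & Hf). apply (H f g gf fg).
  intros v w. rewrite <- !graph_edge. unfold edge. rewrite (Hf R). cbn [map].
  now rewrite map_repeat.
Qed.

Lemma graph_structure_connected :
  (forall v w, clos_refl_trans V E v w) -> connected graph_structure.
Proof.
  intros H a b. specialize (H a b). induction H as [a b Hab|a|a b c _ IH1 _ IH2].
  - apply rt_step. apply (adj_edge graph_structure_Rgraph). now apply graph_edge.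
  - apply rt_refl.
  - eapply rt_trans; eauto.
Qed.

End GraphStructure.

(** In the shortest suffix with a repetition only the first vertex recurs, and the stretch up to its
    return is a simple cycle. It has at least three vertices: there are no loops and no steps
    back. *)
Lemma nbwalk_repeat_cycle (M : structure ar) : is_Rgraph R M -> forall l, nbwalk (@edge M) l -> ~ NoDup l -> has_cycle M.
Proof.
  intros HM l. induction l as [|a l IH]; intros W N.
  { exfalso. apply N. constructor. }
  destruct (classic (NoDup l)) as [Nl|Nl]; [|apply IH; auto; exact (nbwalk_tail _ _ W)].
  assert (Ha : In a l) by (apply NNPP; intros Ha; apply N; now constructor).
  destruct (in_split a l Ha) as (l1 & l2 & ->).
  assert (Hp : forall l1 b, nbwalk (@edge M) (b :: l1 ++ a :: l2) -> adj_path M b l1).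
  { clear - HM HR. intros l1. induction l1 as [|c l1 IH]; intros b W; [exact I|].
    split; [|apply IH; exact (nbwalk_tail _ _ W)].
    apply (adj_edge HM). simpl in W. tauto. }
  exists a, l1. split; [|split; [|split]].
  - constructor.
    + intros H. apply NoDup_remove_2 in Nl. apply Nl, in_or_app; auto.
    + now apply NoDup_app_remove_r in Nl.
  - destruct l1 as [|b [|c l1]]; simpl; try lia; exfalso; simpl in W.
    + destruct W as [W _]. now apply (edge_neq HM) in W.
    + tauto.
  - apply Hp, W.
  - apply (adj_edge HM), nbwalk_last_edge, nbwalk_prefix with l2.
    rewrite <- app_comm_cons, <- app_assoc. exact W.
Qed.

Lemma Rtree_is_tree (M : structure ar) : is_Rtree R M -> is_tree (@edge M).
Proof.
  intros (HM & HC & HN). split.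
  - exact (edge_sym HM).
  - intros a b. specialize (HC a b). induction HC as [a b Hab|a|a b c _ IH1 _ IH2].
    + apply rt_step. now apply (adj_edge HM).
    + apply rt_refl.
    + eapply rt_trans; eauto.
  - intros r x l W HL _. destruct l as [|y l]; [reflexivity|exfalso].
    apply HN. apply (nbwalk_repeat_cycle HM W). intros N. inversion N as [|? ? Hx _]; subst.
    apply Hx. rewrite <- HL at 1. destruct (exists_last (l := y :: l)) as (m & b & e); [easy|].
    rewrite e, last_app_cons. apply in_or_app. simpl; auto.
Qed.

Lemma degree_eq_degree (M : structure ar) : is_Rgraph R M -> forall a n, degree_eq M a n <-> degree (@edge M) a n.
Proof.
  intros HM a n. unfold degree_eq, degree.
  split; intros (l & N & L & H); exists l; (split; [auto|split; [auto|]]);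
    intros b; rewrite <- H; [symmetry|]; apply (adj_edge HM).
Qed.

Lemma TR_rooted (M : structure ar) : is_TR R M -> exists a, rooted_tree (@edge M) a 4.
Proof.
  intros (HT & _ & a & Ha & H). exists a. assert (HM := proj1 HT). split.
  - now apply Rtree_is_tree.
  - now apply degree_eq_degree.
  - intros x Hx. apply degree_eq_degree; auto.
Qed.

Lemma TR'_rooted (M : structure ar) : is_TR' R M -> forall a, rooted_tree (@edge M) a 5.
Proof.
  intros (HT & _ & H) a. assert (HM := proj1 HT). split.
  - now apply Rtree_is_tree.
  - now apply degree_eq_degree.
  - intros x _. apply degree_eq_degree; auto.
Qed.

Lemma TR'_inhabited (M : structure ar) : is_TR' R M -> inhabited (dom M).
Proof.
  intros (_ & HI & _). apply NNPP. intros H. apply HI. exists []. intros x.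
  apply H. constructor; exact x.
Qed.

Lemma rooted_tree_iso (M N : structure ar) a b d : is_Rgraph R M -> is_Rgraph R N ->
  rooted_tree (@edge M) a d -> rooted_tree (@edge N) b d -> iso M N.
Proof.
  intros HM HN T T'. destruct (rooted_tree_unique T T') as (f & g & H).
  exact (iso_of_graph_iso HM HN H).
Qed.

(** * Connected components and the decomposition of forests *)

Section Component.
Variables (V : Type) (E : V -> V -> Prop).
Hypothesis Esym : forall x y, E x y -> E y x.
Hypothesis Eirr : forall x, ~ E x x.
Hypothesis Eacyc : forall r, girth_gt E r.
Variable c : V.

Definition component : Type := {x | clos_refl_trans V E c x}.
Definition component_edge (x y : component) : Prop := E (proj1_sig x) (proj1_sig y).

Lemma component_tree : is_tree component_edge.
Proof.
  assert (Hsym : forall x y, component_edge x y -> component_edge y x)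
    by (intros x y; apply Esym).
  split; [exact Hsym| |].
  - assert (H0 : forall x, clos_refl_trans _ component_edge (exist _ c (rt_refl _ _ _)) x).
    { intros [x Hx]. assert (Hx' := Hx). apply clos_rt_rtn1 in Hx'.
      induction Hx' as [|v w Hs Hv' IH].
      - rewrite (proof_irrelevance _ Hx (rt_refl _ _ _)). apply rt_refl.
      - apply rt_trans with (exist _ v (clos_rtn1_rt _ _ _ _ Hv')); [apply IH|].
        apply rt_step. exact Hs. }
    intros x y. eapply rt_trans; [|apply H0]. apply clos_rt_sym; auto.
  - intros r x l W HL Hr.
    assert (Hw : forall l, nbwalk component_edge l -> nbwalk E (map (@proj1_sig _ _) l)).
    { clear. induction l as [|a l IH]; [auto|]. destruct l as [|b l]; [simpl; auto|].
      intros (H1 & H2 & H3). split; [exact H1|]. split; [|exact (IH H3)].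
      destruct l as [|[d Hd] l]; [exact I|]. destruct a as [a Ha]. simpl in *.
      intros ->. apply H2. now rewrite (proof_irrelevance _ Ha Hd). }
    apply Hw in W. cbn [map] in W.
    assert (e : map (@proj1_sig _ _) l = []).
    { eapply Eacyc; [exact W| |rewrite length_map; exact Hr].
      transitivity (proj1_sig (last l x)); [|now rewrite HL].
      clear. revert x. induction l as [|a l IH]; intros x; [reflexivity|].
      cbn [map]. rewrite !last_cons_default. apply IH. }
    now apply map_eq_nil in e.
Qed.

Lemma component_degree x d : degree E (proj1_sig x) d -> degree component_edge x d.
Proof.
  intros (l & N & <- & Hl). destruct x as [x Hx]. cbn [proj1_sig] in *.
  assert (H : exists l', map (@proj1_sig _ (clos_refl_trans V E c)) l' = l).
  { assert (Hin : forall y, In y l -> E x y) by (intros; now apply Hl). clear N Hl.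
    induction l as [|y l IH]; [exists []; auto|].
    destruct IH as [l' <-]; [simpl in Hin; auto|].
    assert (Hy : clos_refl_trans V E c y).
    { eapply rt_trans; [exact Hx|]. apply rt_step, Hin. simpl; auto. }
    exists (exist _ y Hy :: l'). reflexivity. }
  destruct H as [l' <-]. exists l'. split; [|split].
  - eapply NoDup_map_inv; eauto.
  - now rewrite length_map.
  - intros [y Hy]. unfold component_edge. cbn [proj1_sig]. rewrite Hl, in_map_iff. split.
    + intros ([z Hz] & e & Hin). cbn [proj1_sig] in e. subst z.
      now rewrite (proof_irrelevance _ Hy Hz).
    + intros Hin. exists (exist _ y Hy). auto.
Qed.

End Component.

Section Forest.
Variables (TR TR' M : structure ar).
Hypothesis HTR : is_TR R TR.
Hypothesis HTR' : is_TR' R TR'.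
Hypothesis HM : is_Rgraph R M.

Let V := dom M.
Let E := @edge M.
Let D (v : V) : Prop := degree E v 4.

Hypothesis Hdeg : forall v, degree E v 4 \/ degree E v 5.
Hypothesis Hacyc : forall r, girth_gt E r.
Hypothesis Hsep : forall v w, D v -> D w -> clos_refl_trans V E v w -> v = w.
Hypothesis Hinf : infinite_type {v | D v}.

Let conn := clos_refl_trans V E.

Lemma conn_sym v w : conn v w -> conn w v.
Proof. apply clos_rt_sym. exact (edge_sym HM). Qed.

Lemma edge_irrefl v : ~ E v v.
Proof. intros H. now apply (edge_neq HM) in H. Qed.

(** Connected vertices have equal reachability predicates, so [epsilon] makes the same choice for
    them. *)
Lemma component_representative : exists rep : V -> V,
  (forall v, conn v (rep v)) /\ (forall v w, conn v w -> rep v = rep w).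
Proof.
  set (rep := fun v => epsilon (inhabits v) (conn v)).
  assert (H1 : forall v, conn v (rep v)).
  { intros v. unfold rep. apply epsilon_spec. exists v. apply rt_refl. }
  exists rep. split; [exact H1|].
  intros v w Hvw. unfold rep. rewrite (proof_irrelevance _ (inhabits v) (inhabits w)).
  f_equal. apply functional_extensionality. intros u.
  apply propositional_extensionality.
  split; intros H; eapply rt_trans; eauto. now apply conn_sym.
Qed.

Definition component_structure (c : V) : structure ar := graph_structure (@component_edge V E c).

Lemma component_structure_Rgraph c : is_Rgraph R (component_structure c).
Proof.
  apply graph_structure_Rgraph.
  - intros x y. apply (edge_sym HM).
  - intros x. apply edge_irrefl.
Qed.

Lemma component_structure_rooted c d : degree E c d -> (forall v, conn c v -> v <> c -> degree E v 5) ->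
  exists a, rooted_tree (@edge (component_structure c)) a d.
Proof.
  intros Hc H. exists (exist _ c (rt_refl _ _ _)).
  unfold component_structure. rewrite graph_edge_eq. split.
  - apply component_tree; [exact (edge_sym HM)|exact Hacyc].
  - apply component_degree; [exact (edge_sym HM)|exact Hc].
  - intros [v Hv] Hne. apply component_degree; [exact (edge_sym HM)|]. apply H; [exact Hv|]. cbn [proj1_sig].
    intros ->. apply Hne. f_equal. apply proof_irrelevance.
Qed.

Lemma component_structure_TR c : D c -> iso (component_structure c) TR.
Proof.
  intros Hc. destruct (TR_rooted HTR) as [b Tb].
  destruct (@component_structure_rooted c 4) as [a Ta]; auto.
  - intros v Hv Hne. destruct (Hdeg v) as [Hd|Hd]; [|exact Hd].
    exfalso. apply Hne. symmetry. exact (Hsep Hc Hd Hv).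
  - exact (rooted_tree_iso (component_structure_Rgraph c) (proj1 (proj1 HTR)) Ta Tb).
Qed.

Lemma component_structure_TR' c : (forall v, conn c v -> ~ D v) -> iso (component_structure c) TR'.
Proof.
  intros Hc. destruct (TR'_inhabited HTR') as [b].
  assert (H5 : forall v, conn c v -> degree E v 5).
  { intros v Hv. destruct (Hdeg v) as [Hd|Hd]; [|exact Hd]. exfalso. exact (Hc v Hv Hd). }
  destruct (@component_structure_rooted c 5) as [a Ta]; auto.
  - apply H5, rt_refl.
  - exact (rooted_tree_iso (component_structure_Rgraph c) (proj1 (proj1 HTR')) Ta (TR'_rooted HTR' b)).
Qed.

(** A component with a vertex of degree 4 has only one and is indexed by it, so [I] is infinite by
    [Hinf]; the other components are indexed by chosen representatives. *)
Theorem forest_decomposition : exists (I J : Type) (T : I -> structure ar) (T' : J -> structure ar),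
  infinite_type I /\ (forall i, iso (T i) TR) /\ (forall j, iso (T' j) TR') /\
  iso (disj_union T T') M.
Proof.
  destruct component_representative as (rep & Hrep & Hrep').
  set (I := {v | D v}). set (J := {c | rep c = c /\ forall v, conn c v -> ~ D v}).
  set (T := fun i : I => component_structure (proj1_sig i)).
  set (T' := fun j : J => component_structure (proj1_sig j)).
  exists I, J, T, T'. split; [exact Hinf|].
  split; [intros [i Hi]; now apply component_structure_TR|].
  split; [intros [j [Rj Nj]]; apply component_structure_TR'; exact Nj|].
  set (f := fun u : du_dom T T' => match u with
    | inl u => proj1_sig (projT2 u : component E (proj1_sig (projT1 u)))
    | inr u => proj1_sig (projT2 u : component E (proj1_sig (projT1 u))) end).
  assert (fsurj : forall v, exists u, f u = v).
  { intros v. destruct (classic (exists c, conn v c /\ D c)) as [(c & Hc & Dc)|H].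
    - exists (inl (existT (fun i : I => dom (T i)) (exist _ c Dc) (exist _ v (conn_sym Hc)))).
      reflexivity.
    - assert (Hj : rep (rep v) = rep v /\ forall w, conn (rep v) w -> ~ D w).
      { split; [symmetry; apply Hrep', Hrep|]. intros w Hw Dw. apply H. exists w.
        split; [|auto]. eapply rt_trans; [apply Hrep|exact Hw]. }
      exists (inr (existT (fun j : J => dom (T' j)) (exist _ (rep v) Hj)
                    (exist _ v (conn_sym (Hrep v))))).
      reflexivity. }
  assert (Hmeet : forall a b v, clos_refl_trans V E a v -> clos_refl_trans V E b v -> conn a b).
  { intros a b v Ha Hb. eapply rt_trans; [exact Ha|]. now apply conn_sym. }
  assert (finj : forall u u', f u = f u' -> u = u').
  { intros [[[a Da] [v Hv]]|[[a [Ra Na]] [v Hv]]] [[[b Db] [w Hw]]|[[b [Rb Nb]] [w Hw]]];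
      simpl in *; intros <-.
    - assert (a = b) by (apply Hsep; auto; eapply Hmeet; eauto). subst b.
      rewrite (proof_irrelevance _ Db Da), (proof_irrelevance _ Hw Hv). reflexivity.
    - exfalso. apply (Nb a); auto. eapply Hmeet; eauto.
    - exfalso. apply (Na b); auto. eapply Hmeet; eauto.
    - assert (a = b) by (rewrite <- Ra, <- Rb; apply Hrep'; eapply Hmeet; eauto). subst b.
      rewrite (proof_irrelevance _ Rb Ra), (proof_irrelevance _ Nb Na), (proof_irrelevance _ Hw Hv).
      reflexivity. }
  set (g := fun v => proj1_sig (constructive_indefinite_description _ (fsurj v))).
  assert (fg : forall v, f (g v) = v) by (intros; unfold g; apply proj2_sig).
  assert (HN : is_Rgraph R (disj_union T T')).
  { split.
    - intros S t HS [(i & u & H & _)|(j & u & H & _)];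
        eapply (proj1 (component_structure_Rgraph _)); eauto.
    - intros t [(i & u & H & ->)|(j & u & H & ->)];
        destruct (proj2 (component_structure_Rgraph _) _ H) as (a & b & Hn & -> & H').
      + exists (inl (existT (fun i => dom (T i)) i a)), (inl (existT (fun i => dom (T i)) i b)).
        split; [|split].
        * intros e. apply Hn. apply (f_equal f) in e. simpl in e. revert e. clear.
          destruct a as [a Ha], b as [b Hb]. simpl. intros ->. f_equal. apply proof_irrelevance.
        * simpl. now rewrite map_repeat.
        * left. exists i, (b :: repeat a (ar R - 1)). split; [exact H'|].
          simpl. now rewrite map_repeat.
      + exists (inr (existT (fun j => dom (T' j)) j a)), (inr (existT (fun j => dom (T' j)) j b)).
        split; [|split].
        * intros e. apply Hn. apply (f_equal f) in e. simpl in e. revert e. clear.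
          destruct a as [a Ha], b as [b Hb]. simpl. intros ->. f_equal. apply proof_irrelevance.
        * simpl. now rewrite map_repeat.
        * right. exists j, (b :: repeat a (ar R - 1)). split; [exact H'|].
          simpl. now rewrite map_repeat. }
  apply (@iso_of_graph_iso (disj_union T T') M HN HM f g).
  split; [intros u; apply finj, fg|]. split; [exact fg|].
  intros u u'. split.
  - intros [(i & w & H & e)|(j & w & H & e)];
      destruct (proj2 (component_structure_Rgraph _) _ H) as (a & b & _ & -> & _);
      cbn [map] in e; rewrite map_repeat in e; apply edge_tuple_inj in e;
      destruct e as [-> ->]; apply graph_edge in H; exact H.
  - assert (Hadj : forall c (v w : component E c), E (proj1_sig v) (proj1_sig w) ->
        rel (component_structure c) R (v :: repeat w (ar R - 1))).
    { intros c v w H. apply graph_edge. exact H. }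
    destruct u as [[[a Da] [v Hv]]|[[a [Ra Na]] [v Hv]]],
      u' as [[[b Db] [w Hw]]|[[b [Rb Nb]] [w Hw]]]; simpl; intros Hvw;
      assert (Haw : conn a w) by (eapply rt_trans; [exact Hv|now apply rt_step]).
    + assert (a = b) by (apply Hsep; auto; eapply Hmeet; eauto). subst b.
      rewrite (proof_irrelevance _ Db Da). left. eexists (exist _ a Da), _. split.
      * exact (Hadj a (exist _ v Hv) (exist _ w Hw) Hvw).
      * simpl. now rewrite map_repeat.
    + exfalso. apply (Nb a); auto. eapply Hmeet; eauto.
    + exfalso. apply (Na b); auto. eapply Hmeet; eauto.
    + assert (a = b) by (rewrite <- Ra, <- Rb; apply Hrep'; eapply Hmeet; eauto). subst b.
      rewrite (proof_irrelevance _ Rb Ra), (proof_irrelevance _ Nb Na).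
      right. eexists (exist _ a (conj Ra Na)), _. split.
      * exact (Hadj a (exist _ v Hv) (exist _ w Hw) Hvw).
      * simpl. now rewrite map_repeat.
Qed.

End Forest.
End Structures.

(** * Ultraproducts *)

(** An extension of the filter of cofinite sets. *)
Lemma ultrafilter_exists : exists U : (nat -> Prop) -> Prop,
  (forall A B : nat -> Prop, (forall n, A n -> B n) -> U A -> U B) /\
  (forall A B, U A -> U B -> U (fun n => A n /\ B n)) /\
  ~ U (fun _ => False) /\
  (forall A, U A \/ U (fun n => ~ A n)) /\
  (forall k, U (fun n => k <= n)).
Proof.
  set (F := fun A : nat -> Prop => exists k, forall n, k <= n -> A n).
  assert (PF : filter.ProperFilter F).
  { constructor.
    - intros [k H]. exact (H k (le_n k)).
    - constructor.
      + exists 0. intros n _. exact I.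
      + intros A B [k H] [k' H']. exists (k + k'). intros n Hn. split; [apply H|apply H']; lia.
      + intros A B HAB [k H]. exists k. intros n Hn. apply HAB, H, Hn. }
  destruct (filter.ultraFilterLemma PF) as (U & HU & HFU).
  destruct (@filter.ultra_proper nat U HU) as [U0 [UT UI US]].
  exists U. split; [|split; [|split; [|split]]].
  - intros A B H HA. exact (US A B H HA).
  - intros A B HA HB. exact (UI A B HA HB).
  - exact U0.
  - intros A. exact (filter.in_ultra_setVsetC A HU).
  - intros k. apply HFU. exists k. auto.
Qed.

Lemma lookup_all_map (X Y : Type) (f : X -> Y) env vs :
  lookup_all (map f env) vs = option_map (map f) (lookup_all env vs).
Proof.
  induction vs as [|v vs IH]; [reflexivity|]. simpl. rewrite nth_error_map, IH.
  destruct (nth_error env v), (lookup_all env vs); reflexivity.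
Qed.

Section Ultraproduct.
Variables (Sym : Type) (ar : Sym -> nat) (Ms : nat -> structure ar).
Hypothesis Mne : forall n, inhabited (dom (Ms n)).
Variable U : (nat -> Prop) -> Prop.
Hypothesis U_up : forall A B : nat -> Prop, (forall n, A n -> B n) -> U A -> U B.
Hypothesis U_and : forall A B, U A -> U B -> U (fun n => A n /\ B n).
Hypothesis U_proper : ~ U (fun _ => False).
Hypothesis U_ultra : forall A, U A \/ U (fun n => ~ A n).

Lemma U_ext (A B : nat -> Prop) : (forall n, A n <-> B n) -> (U A <-> U B).
Proof. intros H. split; apply U_up; intros n; apply H. Qed.

Lemma U_and_iff A B : U (fun n => A n /\ B n) <-> U A /\ U B.
Proof.
  split.
  - intros H. split; revert H; apply U_up; tauto.
  - intros [HA HB]. auto.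
Qed.

Lemma U_not_iff A : U (fun n => ~ A n) <-> ~ U A.
Proof.
  split.
  - intros H HA. apply U_proper. apply U_up with (2 := U_and H HA). tauto.
  - intros H. destruct (U_ultra A); tauto.
Qed.

Lemma U_or_iff A B : U (fun n => A n \/ B n) <-> U A \/ U B.
Proof.
  rewrite (U_ext _ (fun n => ~ (~ A n /\ ~ B n))) by (intros; tauto).
  rewrite U_not_iff, U_and_iff, !U_not_iff. tauto.
Qed.

Lemma U_imp_iff (A B : nat -> Prop) : U (fun n => A n -> B n) <-> (U A -> U B).
Proof.
  rewrite (U_ext _ (fun n => ~ A n \/ B n)) by (intros; tauto).
  rewrite U_or_iff, U_not_iff. tauto.
Qed.

Lemma U_const (P : Prop) : U (fun _ => P) <-> P.
Proof.
  split.
  - intros H. apply NNPP. intros HP. apply U_proper. revert H. apply U_up. tauto.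
  - intros H. destruct (U_ultra (fun _ => P)) as [|H']; [auto|].
    exfalso. apply U_proper. revert H'. apply U_up. tauto.
Qed.

Definition thread : Type := forall n, dom (Ms n).
Definition thread_eq (f g : thread) : Prop := U (fun n => f n = g n).

Lemma thread_eq_trans f g h : thread_eq f g -> thread_eq g h -> thread_eq f h.
Proof. intros H1 H2. apply U_up with (2 := U_and H1 H2). intros n [-> ->]. reflexivity. Qed.

Lemma thread_eq_sym f g : thread_eq f g -> thread_eq g f.
Proof. apply U_up. auto. Qed.

Lemma thread_eq_refl f : thread_eq f f.
Proof. apply U_up with (A := fun _ => True); [auto|]. now apply U_const. Qed.

Definition thread_rep (f : thread) : thread := epsilon (inhabits f) (thread_eq f).

Lemma thread_rep_eq f : thread_eq f (thread_rep f).
Proof. unfold thread_rep. apply epsilon_spec. exists f. apply thread_eq_refl. Qed.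

Lemma thread_rep_congr f g : thread_eq f g -> thread_rep f = thread_rep g.
Proof.
  intros H. unfold thread_rep. rewrite (proof_irrelevance _ (inhabits f) (inhabits g)).
  f_equal. apply functional_extensionality. intros h. apply propositional_extensionality.
  split; intros H'; eapply thread_eq_trans; eauto. now apply thread_eq_sym.
Qed.

(* The quotient by [thread_eq], realised on chosen representatives. *)
Definition uprod_dom : Type := {f : thread | thread_rep f = f}.

Definition at_index (n : nat) (x : uprod_dom) : dom (Ms n) := proj1_sig x n.

Definition uprod_class (f : thread) : uprod_dom :=
  exist _ (thread_rep f) (eq_sym (thread_rep_congr (thread_rep_eq f))).

Lemma uprod_class_at f : U (fun n => at_index n (uprod_class f) = f n).
Proof. apply thread_eq_sym. exact (thread_rep_eq f). Qed.

Lemma uprod_eq (x y : uprod_dom) : x = y <-> U (fun n => at_index n x = at_index n y).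
Proof.
  split.
  - intros ->. apply thread_eq_refl.
  - intros H. change (thread_eq (proj1_sig x) (proj1_sig y)) in H.
    apply thread_rep_congr in H. destruct x as [x Hx], y as [y Hy]. simpl in H.
    assert (e : x = y) by congruence. subst y. f_equal. apply proof_irrelevance.
Qed.

Definition uprod_rel (S : Sym) (t : list uprod_dom) : Prop :=
  U (fun n => rel (Ms n) S (map (at_index n) t)).

Lemma uprod_rel_ar S t : uprod_rel S t -> length t = ar S.
Proof.
  intros H. apply NNPP. intros Hn. apply U_proper. revert H. apply U_up. intros n H.
  apply Hn. rewrite <- (length_map (at_index n)). exact (rel_ar _ _ _ H).
Qed.

Definition ultraproduct : structure ar := Struct ar uprod_rel uprod_rel_ar.

Theorem los (phi : fo_formula Sym) : forall env : list uprod_dom,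
  fo_sat ultraproduct env phi <-> U (fun n => fo_sat (Ms n) (map (at_index n) env) phi).
Proof.
  induction phi as [i j|S vs|p IH|p IHp q IHq|p IHp q IHq|p IHp q IHq|p IH|p IH];
    intros env; cbn [fo_sat]; change (dom ultraproduct) with uprod_dom.
  - rewrite (U_ext _ (fun n => exists x, option_map (at_index n) (nth_error env i) = Some x /\
      option_map (at_index n) (nth_error env j) = Some x))
      by (intros n; now rewrite !nth_error_map).
    destruct (nth_error env i) as [x|], (nth_error env j) as [y|]; cbn [option_map].
    + rewrite (U_ext _ (fun n => at_index n x = at_index n y)), <- uprod_eq.
      * split; [intros (z & H1 & H2); congruence|intros ->; eauto].
      * intros n. split; [intros (z & H1 & H2); congruence|intros ->; eauto].
    + rewrite (U_ext _ (fun _ => False)), U_const; [|intros n]; firstorder discriminate.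
    + rewrite (U_ext _ (fun _ => False)), U_const; [|intros n]; firstorder discriminate.
    + rewrite (U_ext _ (fun _ => False)), U_const; [|intros n]; firstorder discriminate.
  - rewrite (U_ext _ (fun n => exists t, option_map (map (at_index n)) (lookup_all env vs) = Some t /\
      rel (Ms n) S t)) by (intros n; now rewrite lookup_all_map).
    destruct (lookup_all env vs) as [t|]; cbn [option_map].
    + rewrite (U_ext _ (fun n => rel (Ms n) S (map (at_index n) t))).
      * split; [intros (t' & H1 & H2); injection H1 as <-; exact H2|].
        intros H. exists t. split; [reflexivity|exact H].
      * intros n. split; [intros (t' & H1 & H2); congruence|eauto].
    + rewrite (U_ext _ (fun _ => False)), U_const; [|intros n]; firstorder discriminate.
  - rewrite U_not_iff, IH. tauto.
  - rewrite U_and_iff, IHp, IHq. tauto.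
  - rewrite U_or_iff, IHp, IHq. tauto.
  - rewrite U_imp_iff, IHp, IHq. tauto.
  - split.
    + intros (x & Hx). apply IH in Hx. revert Hx. apply U_up. intros n Hn.
      exists (at_index n x). exact Hn.
    + intros H.
      (* Indices without a witness receive an arbitrary element; this is where the structures must
         be nonempty. *)
      assert (Hch : forall n, exists a, (exists x, fo_sat (Ms n) (x :: map (at_index n) env) p) ->
                fo_sat (Ms n) (a :: map (at_index n) env) p).
      { intros n. destruct (classic (exists x, fo_sat (Ms n) (x :: map (at_index n) env) p))
          as [[a Ha]|Hn]; [eauto|].
        destruct (Mne n) as [a]. exists a. tauto. }
      set (f := fun n => proj1_sig (constructive_indefinite_description _ (Hch n)) : dom (Ms n)).
      assert (Hf : forall n, (exists x, fo_sat (Ms n) (x :: map (at_index n) env) p) ->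
                fo_sat (Ms n) (f n :: map (at_index n) env) p) by (intros n; apply proj2_sig).
      exists (uprod_class f). apply IH.
      apply U_up with (2 := U_and H (uprod_class_at f)). intros n [H1 H2].
      cbn [map]. rewrite H2. auto.
  - split.
    + intros H. apply NNPP. intros HU. apply U_not_iff in HU.
      assert (Hch : forall n, exists a, ~ (forall x, fo_sat (Ms n) (x :: map (at_index n) env) p) ->
                ~ fo_sat (Ms n) (a :: map (at_index n) env) p).
      { intros n. destruct (classic (forall x, fo_sat (Ms n) (x :: map (at_index n) env) p))
          as [Ha|Hn].
        - destruct (Mne n) as [a]. exists a. tauto.
        - apply not_all_ex_not in Hn. destruct Hn as [a Ha]. eauto. }
      set (f := fun n => proj1_sig (constructive_indefinite_description _ (Hch n)) : dom (Ms n)).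
      assert (Hf : forall n, ~ (forall x, fo_sat (Ms n) (x :: map (at_index n) env) p) ->
                ~ fo_sat (Ms n) (f n :: map (at_index n) env) p) by (intros n; apply proj2_sig).
      assert (Hx := proj1 (IH _) (H (uprod_class f))).
      apply U_proper. apply U_up with (2 := U_and (U_and HU Hx) (uprod_class_at f)).
      intros n [[H1 H2] H3]. cbn [map] in H2. rewrite H3 in H2. exact (Hf n H1 H2).
    + intros H x. apply IH. revert H. apply U_up. intros n Hn. apply Hn.
Qed.

End Ultraproduct.

(** This takes the place of compactness: for sentences that hold eventually along one sequence, an
    ultrafilter on [nat] containing all tails suffices. *)
Theorem fo_limit_model (Sym : Type) (ar : Sym -> nat) (Ms : nat -> structure ar) :
  (forall n, inhabited (dom (Ms n))) ->
  exists M : structure ar, forall phi,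
    (exists k, forall n, k <= n -> fo_sat (Ms n) [] phi) -> fo_sat M [] phi.
Proof.
  intros Mne. destruct ultrafilter_exists as (U & U1 & U2 & U3 & U4 & U5).
  exists (ultraproduct Ms U U1 U3). intros phi [k Hk]. apply (los Mne U1 U2 U3 U4).
  apply U1 with (2 := U5 k). exact Hk.
Qed.

(** * First-order definability *)

Section Definability.
Variables (Sym : Type) (ar : Sym -> nat).

Lemma fo_sat_iso (M N : structure ar) (f : dom M -> dom N) (g : dom N -> dom M)
  (gf : forall x, g (f x) = x) (fg : forall y, f (g y) = y)
  (fR : forall S t, rel M S t <-> rel N S (map f t)) (phi : fo_formula Sym) :
  forall env, fo_sat M env phi <-> fo_sat N (map f env) phi.
Proof.
  induction phi as [i j|S vs|p IH|p IHp q IHq|p IHp q IHq|p IHp q IHq|p IH|p IH];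
    intros env; cbn [fo_sat].
  - rewrite !nth_error_map. split.
    + intros (x & -> & ->). exists (f x). auto.
    + intros (y & Hi & Hj).
      destruct (nth_error env i) as [x|], (nth_error env j) as [x'|]; try discriminate.
      exists x. split; [reflexivity|]. cbn in Hi, Hj.
      rewrite <- (gf x), <- (gf x'). congruence.
  - rewrite lookup_all_map. destruct (lookup_all env vs) as [t|]; cbn [option_map].
    + split; [intros (t' & H1 & H2)|intros (t' & H1 & H2)]; injection H1 as <-.
      * exists (map f t). split; [reflexivity|]. now apply fR.
      * exists t. split; [reflexivity|]. now apply fR.
    + split; intros (t & H1 & _); discriminate.
  - rewrite IH. tauto.
  - rewrite IHp, IHq. tauto.
  - rewrite IHp, IHq. tauto.
  - rewrite IHp, IHq. tauto.
  - split.
    + intros (x & H). exists (f x). now apply IH in H.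
    + intros (y & H). exists (g y). apply IH. cbn [map]. now rewrite fg.
  - split.
    + intros H y. specialize (H (g y)). apply IH in H. cbn [map] in H. now rewrite fg in H.
    + intros H x. apply IH. apply H.
Qed.

Lemma fo_class_iso_closed (phi : fo_formula Sym) :
  iso_closed (fun M : structure ar => fo_sat M [] phi).
Proof.
  intros M N (f & g & gf & fg & fR) H. exact (proj1 (fo_sat_iso _ _ f g gf fg fR phi []) H).
Qed.

Definition query : Type := forall M : structure ar, list (dom M) -> Prop.

(* The formula may be asked for at any choice [js] of variables, so that queries can be composed without renaming formulas. *)
Definition definable (m : nat) (Q : query) : Prop :=
  forall k js, length js = m -> (forall j, In j js -> j < k) ->
  exists phi : fo_formula Sym, fo_wf k phi /\
    forall (M : structure ar) env vals, length env = k -> lookup_all env js = Some vals ->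
      (fo_sat M env phi <-> Q M vals).

Lemma lookup_all_length (X : Type) (env : list X) js : forall vals,
  lookup_all env js = Some vals -> length vals = length js.
Proof.
  induction js as [|j js IH]; simpl; intros vals H; [now injection H as <-|].
  destruct (nth_error env j); [|discriminate].
  destruct (lookup_all env js) as [xs|]; [|discriminate].
  injection H as <-. simpl. now rewrite (IH xs).
Qed.

Lemma lookup_all_nth (X : Type) (env : list X) js : forall vals i,
  lookup_all env js = Some vals -> i < length js ->
  nth_error vals i = nth_error env (nth i js 0).
Proof.
  induction js as [|j js IH]; simpl; intros vals i H Hi; [lia|].
  destruct (nth_error env j) as [x|] eqn:Hj; [|discriminate].
  destruct (lookup_all env js) as [xs|]; [|discriminate].
  injection H as <-. destruct i as [|i]; simpl; [auto|]. apply IH; [auto|lia].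
Qed.

Lemma lookup_all_sub (X : Type) (env : list X) js vals sg :
  lookup_all env js = Some vals -> (forall i, In i sg -> i < length js) ->
  lookup_all env (map (fun i => nth i js 0) sg) = lookup_all vals sg.
Proof.
  intros H. induction sg as [|i sg IH]; intros Hsg; [reflexivity|]. simpl.
  rewrite IH by (intros; apply Hsg; simpl; auto).
  rewrite (lookup_all_nth _ _ H); [reflexivity|]. apply Hsg; simpl; auto.
Qed.

Lemma lookup_all_total (X : Type) (vals : list X) sg :
  (forall i, In i sg -> i < length vals) -> exists w, lookup_all vals sg = Some w.
Proof.
  induction sg as [|i sg IH]; intros H; [exists []; reflexivity|].
  destruct IH as [w Hw]; [intros; apply H; simpl; auto|]. simpl. rewrite Hw.
  destruct (nth_error vals i) eqn:Hi; [eauto|].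
  apply nth_error_None in Hi. specialize (H i (or_introl eq_refl)). lia.
Qed.

Lemma lookup_all_shift (X : Type) (x : X) env js :
  lookup_all (x :: env) (map S js) = lookup_all env js.
Proof. induction js as [|j js IH]; simpl; [|rewrite IH]; reflexivity. Qed.

Lemma sub_bound js k sg m : length js = m -> (forall j, In j js -> j < k) ->
  (forall i, In i sg -> i < m) -> forall j, In j (map (fun i => nth i js 0) sg) -> j < k.
Proof.
  intros <- Hjs Hsg j Hj. apply in_map_iff in Hj. destruct Hj as (i & <- & Hi).
  apply Hjs, nth_In. auto.
Qed.

Lemma definable_ext m (Q Q' : query) :
  (forall M v, length v = m -> (Q M v <-> Q' M v)) -> definable m Q -> definable m Q'.
Proof.
  intros H D k js Hl Hb. destruct (D k js Hl Hb) as (phi & W & Hphi).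
  exists phi. split; [exact W|]. intros M env vals He Hv.
  rewrite (Hphi M env vals He Hv). apply H. rewrite <- Hl. now apply lookup_all_length in Hv.
Qed.

Lemma definable_not m Q : definable m Q -> definable m (fun M v => ~ Q M v).
Proof.
  intros D k js Hl Hb. destruct (D k js Hl Hb) as (phi & W & Hphi).
  exists (FNot phi). split; [exact W|]. intros M env vals He Hv. cbn [fo_sat].
  rewrite (Hphi M env vals He Hv). tauto.
Qed.

Lemma definable_and m Q Q' : definable m Q -> definable m Q' ->
  definable m (fun M v => Q M v /\ Q' M v).
Proof.
  intros D D' k js Hl Hb. destruct (D k js Hl Hb) as (phi & W & Hphi).
  destruct (D' k js Hl Hb) as (psi & W' & Hpsi).
  exists (FAnd phi psi). split; [split; auto|]. intros M env vals He Hv. cbn [fo_sat].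
  rewrite (Hphi M env vals He Hv), (Hpsi M env vals He Hv). tauto.
Qed.

Lemma definable_imp m Q Q' : definable m Q -> definable m Q' ->
  definable m (fun M v => Q M v -> Q' M v).
Proof.
  intros D D' k js Hl Hb. destruct (D k js Hl Hb) as (phi & W & Hphi).
  destruct (D' k js Hl Hb) as (psi & W' & Hpsi).
  exists (FImp phi psi). split; [split; auto|]. intros M env vals He Hv. cbn [fo_sat].
  rewrite (Hphi M env vals He Hv), (Hpsi M env vals He Hv). tauto.
Qed.

Lemma definable_iff m Q Q' : definable m Q -> definable m Q' ->
  definable m (fun M v => Q M v <-> Q' M v).
Proof. intros D D'. apply definable_and; apply definable_imp; assumption. Qed.

Lemma definable_or m Q Q' : definable m Q -> definable m Q' ->
  definable m (fun M v => Q M v \/ Q' M v).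
Proof.
  intros D D'. apply definable_ext with (fun M v => ~ Q M v -> Q' M v).
  - intros M v _. tauto.
  - apply definable_imp; [now apply definable_not|auto].
Qed.

Lemma definable_all m Q : definable (S m) Q -> definable m (fun M v => forall x, Q M (x :: v)).
Proof.
  intros D k js Hl Hb. destruct (D (S k) (0 :: map S js)) as (phi & W & Hphi).
  - simpl. now rewrite length_map, Hl.
  - intros j [<-|Hj]; [lia|]. apply in_map_iff in Hj. destruct Hj as (i & <- & Hi).
    specialize (Hb i Hi). lia.
  - exists (FAll phi). split; [exact W|]. intros M env vals He Hv. cbn [fo_sat].
    assert (H : forall x, fo_sat M (x :: env) phi <-> Q M (x :: vals)).
    { intros x. apply Hphi; [simpl; auto|]. cbn [lookup_all nth_error].
      now rewrite lookup_all_shift, Hv. }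
    split; intros H' x; apply H; apply H'.
Qed.

Lemma definable_ex m Q : definable (S m) Q -> definable m (fun M v => exists x, Q M (x :: v)).
Proof.
  intros D. apply definable_ext with (fun M v => ~ forall x, ~ Q M (x :: v)).
  - intros M v _. split.
    + intros H. apply NNPP. intros H'. apply H. intros x Hx. apply H'. eauto.
    + intros [x Hx] H. exact (H x Hx).
  - apply definable_not, (definable_all (Q := fun M v => ~ Q M v)), definable_not, D.
Qed.

Lemma definable_eq m i j : i < m -> j < m ->
  definable m (fun M v => nth_error v i = nth_error v j).
Proof.
  intros Hi Hj k js Hl Hb. subst m. exists (FEq _ (nth i js 0) (nth j js 0)).
  split; [split; apply Hb, nth_In; auto|]. intros M env vals He Hv. cbn [fo_sat].
  rewrite <- (lookup_all_nth _ _ Hv Hi), <- (lookup_all_nth _ _ Hv Hj).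
  apply lookup_all_length in Hv. split.
  - intros (x & -> & ->). reflexivity.
  - intros e. destruct (nth_error vals i) as [x|] eqn:Hx.
    + exists x. auto.
    + apply nth_error_None in Hx. lia.
Qed.

Lemma definable_rel m (S : Sym) sg : (forall i, In i sg -> i < m) ->
  definable m (fun M v => exists t, lookup_all v sg = Some t /\ rel M S t).
Proof.
  intros Hsg k js Hl Hb. exists (FRel S (map (fun i => nth i js 0) sg)).
  split; [exact (@sub_bound js k sg m Hl Hb Hsg)|]. intros M env vals He Hv. cbn [fo_sat].
  rewrite (lookup_all_sub _ _ _ Hv); [tauto|]. now rewrite Hl.
Qed.

Lemma definable_sub m m' (Q : query) sg : definable m Q -> length sg = m ->
  (forall i, In i sg -> i < m') ->
  definable m' (fun M v => exists w, lookup_all v sg = Some w /\ Q M w).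
Proof.
  intros D Hm Hsg k js Hl Hb.
  destruct (D k (map (fun i => nth i js 0) sg)) as (phi & W & Hphi).
  - now rewrite length_map.
  - exact (@sub_bound js k sg m' Hl Hb Hsg).
  - exists phi. split; [exact W|]. intros M env vals He Hv.
    destruct (@lookup_all_total _ vals sg) as [w Hw].
    { intros i Hi. rewrite (lookup_all_length _ _ Hv), Hl. auto. }
    rewrite (Hphi M env w He).
    + split; [eauto|]. intros (w' & e & H). congruence.
    + rewrite (lookup_all_sub _ _ _ Hv); [exact Hw|]. now rewrite Hl.
Qed.

(** For conditions on parameters such as [s <> R] or [i = j]: their truth does not depend on the
    structure, so it is decided outside the formula. *)
Lemma definable_const m (P : Prop) : definable m (fun _ _ => P).
Proof.
  assert (T : definable m (fun _ _ => True)).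
  { apply definable_ext with (fun M v => forall x : dom M, nth_error (x :: v) 0 = nth_error (x :: v) 0).
    - intros; simpl; tauto.
    - apply (definable_all (Q := fun M v => nth_error v 0 = nth_error v 0)), definable_eq; lia. }
  destruct (classic P) as [HP|HP].
  - apply definable_ext with (2 := T). intros; tauto.
  - apply definable_ext with (2 := definable_not T). intros; tauto.
Qed.

Lemma definable_forall_in m (Q : nat -> query) l : (forall i, In i l -> definable m (Q i)) ->
  definable m (fun M v => forall i, In i l -> Q i M v).
Proof.
  induction l as [|i l IH]; intros H.
  - apply definable_ext with (2 := @definable_const m True). simpl; tauto.
  - apply definable_ext with (fun M v => Q i M v /\ forall i, In i l -> Q i M v).
    + intros M v _. simpl. split.
      * intros [H1 H2] j [<-|Hj]; auto.
      * intros H'. split; [|intros j Hj]; apply H'; auto.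
    + apply definable_and; [apply H; simpl; auto|]. apply IH. intros; apply H; simpl; auto.
Qed.

Lemma definable_exists_in m (Q : nat -> query) l : (forall i, In i l -> definable m (Q i)) ->
  definable m (fun M v => exists i, In i l /\ Q i M v).
Proof.
  intros H. apply definable_ext with (fun M v => ~ forall i, In i l -> ~ Q i M v).
  - intros M v _. split.
    + intros H1. apply NNPP. intros H2. apply H1. intros i Hi HQ. apply H2. eauto.
    + intros (i & Hi & HQ) H1. exact (H1 i Hi HQ).
  - apply definable_not, (definable_forall_in (fun i M v => ~ Q i M v)).
    intros i Hi. now apply definable_not, H.
Qed.

Lemma definable_all_list k m Q : definable (k + m) Q ->
  definable m (fun M v => forall l, length l = k -> Q M (l ++ v)).
Proof.
  revert m Q. induction k as [|k IH]; intros m Q D.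
  - apply definable_ext with (2 := D). intros M v _. split.
    + intros H [|]; [auto|discriminate].
    + intros H. exact (H [] eq_refl).
  - apply definable_ext with (fun M v => forall l, length l = k -> forall x, Q M (x :: l ++ v)).
    + intros M v _. split.
      * intros H [|x l] Hl; [discriminate|]. apply (H l); auto.
      * intros H l Hl x. apply (H (x :: l)). simpl; auto.
    + apply (IH m (fun M v => forall x, Q M (x :: v))), definable_all, D.
Qed.

Lemma definable_ex_list k m Q : definable (k + m) Q ->
  definable m (fun M v => exists l, length l = k /\ Q M (l ++ v)).
Proof.
  intros D. apply definable_ext with (fun M v => ~ forall l, length l = k -> ~ Q M (l ++ v)).
  - intros M v _. split.
    + intros H1. apply NNPP. intros H2. apply H1. intros l Hl HQ. apply H2. eauto.
    + intros (l & Hl & HQ) H1. exact (H1 l Hl HQ).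
  - apply definable_not, (@definable_all_list k m (fun M v => ~ Q M v)).
    now apply definable_not.
Qed.

Lemma definable_sentence Q : definable 0 Q ->
  exists phi, fo_sentence phi /\ forall M : structure ar, fo_sat M [] phi <-> Q M [].
Proof.
  intros D. destruct (D 0 [] eq_refl) as (phi & W & H); [intros j []|].
  exists phi. split; [exact W|]. intros M. now apply H.
Qed.

Definition unary (P : forall M : structure ar, dom M -> Prop) : query :=
  fun M v => match v with [x] => P M x | _ => False end.
Definition binary (P : forall M : structure ar, dom M -> dom M -> Prop) : query :=
  fun M v => match v with [x; y] => P M x y | _ => False end.
Definition ternary (P : forall M : structure ar, dom M -> dom M -> dom M -> Prop) : query :=
  fun M v => match v with [x; y; z] => P M x y z | _ => False end.

Lemma exists_Some (X : Type) (x : X) (P : X -> Prop) : (exists w, Some x = Some w /\ P w) <-> P x.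
Proof. split; [intros (w & e & H); congruence|eauto]. Qed.

Lemma nth_error_in (X : Type) (l : list X) y :
  In y l <-> exists i, In i (seq 0 (length l)) /\ nth_error l i = Some y.
Proof.
  split.
  - intros H. destruct (In_nth_error l y H) as [i Hi]. exists i. split; [|exact Hi].
    apply in_seq. assert (i < length l) by (apply nth_error_Some; congruence). lia.
  - intros (i & _ & Hi). exact (nth_error_In l i Hi).
Qed.

Lemma nodup_positions (X : Type) (l l' : list X) :
  NoDup l <-> forall i, In i (seq 0 (length l)) -> forall j, In j (seq 0 (length l)) ->
     nth_error (l ++ l') i = nth_error (l ++ l') j -> i = j.
Proof.
  rewrite NoDup_nth_error. split.
  - intros H i Hi j Hj e. apply in_seq in Hi, Hj.
    rewrite !nth_error_app1 in e by lia. apply H; [lia|exact e].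
  - intros H i j Hi e.
    assert (Hj : j < length l) by (apply nth_error_Some; rewrite <- e; now apply nth_error_Some).
    apply H; [apply in_seq; lia|apply in_seq; lia|]. now rewrite !nth_error_app1.
Qed.

Lemma definable_nodup k m : definable (k + m)
  (fun M v => forall i, In i (seq 0 k) -> forall j, In j (seq 0 k) ->
     nth_error v i = nth_error v j -> i = j).
Proof.
  apply definable_forall_in. intros i Hi. apply definable_forall_in. intros j Hj.
  apply in_seq in Hi, Hj. apply definable_imp; [apply definable_eq; lia|apply definable_const].
Qed.

Definition rel_empty (S : Sym) (M : structure ar) : Prop := forall t, ~ rel M S t.

Lemma definable_rel_empty S : definable 0 (fun M _ => rel_empty S M).
Proof.
  apply definable_ext with (fun M v => forall l, length l = ar S ->
    ~ exists t, lookup_all (l ++ v) (seq 0 (ar S)) = Some t /\ rel M S t).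
  - intros M [|] Hl; [|discriminate].
    assert (Hseq : forall l : list (dom M), lookup_all (l ++ []) (seq 0 (length l)) = Some l).
    { intros l. rewrite app_nil_r. induction l as [|x l IH]; [reflexivity|].
      cbn [length seq lookup_all nth_error]. rewrite <- seq_shift, lookup_all_shift, IH. reflexivity. }
    split.
    + intros H t Ht. assert (L := rel_ar M S t Ht). apply (H t L). exists t. split; [|exact Ht].
      rewrite <- L. apply Hseq.
    + intros H l L (t & _ & Ht). exact (H t Ht).
  - apply (@definable_all_list (ar S) 0 (fun M v =>
      ~ exists t, lookup_all v (seq 0 (ar S)) = Some t /\ rel M S t)).
    apply definable_not, definable_rel. intros i Hi. apply in_seq in Hi. lia.
Qed.

(** * First-order axioms for the forests *)

Variable R : Sym.
Hypothesis HR : 2 <= ar R.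
Let k := ar R - 1.

Lemma lookup_repeat (X : Type) (v : list X) i y n : nth_error v i = Some y ->
  lookup_all v (repeat i n) = Some (repeat y n).
Proof. intros H. induction n as [|n IH]; [reflexivity|]. simpl. now rewrite H, IH. Qed.

Lemma definable_edge : definable 2 (binary (edge R)).
Proof.
  apply definable_ext with (fun M v => exists t, lookup_all v (0 :: repeat 1 k) = Some t /\ rel M R t).
  - intros M [|x [|y [|]]] Hl; try discriminate. cbn [lookup_all nth_error].
    rewrite lookup_repeat with (y := y) by reflexivity. rewrite exists_Some. reflexivity.
  - apply definable_rel. intros i [<-|Hi]; [lia|]. apply repeat_spec in Hi. lia.
Qed.

Lemma definable_degree d : definable 1 (unary (fun M x => degree (edge R M) x d)).
Proof.
  (* Layout of [w]: position 0 is the candidate [y], positions 1 to [d] are the listed neighbours,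
     position [S d] is [x]. *)
  set (Q2 := (fun M w => (exists t, lookup_all w [S d; 0] = Some t /\ binary (edge R) M t) <->
     exists i, In i (seq 0 d) /\ nth_error w 0 = nth_error w (S i)) : query).
  set (Q1 := (fun M u => (forall i, In i (seq 0 d) -> forall j, In j (seq 0 d) ->
     nth_error u i = nth_error u j -> i = j) /\ forall y, Q2 M (y :: u)) : query).
  assert (D2 : definable (S (d + 1)) Q2).
  { apply definable_iff.
    - apply (definable_sub _ definable_edge); [reflexivity|]. intros i [<-|[<-|[]]]; lia.
    - apply definable_exists_in. intros i Hi. apply in_seq in Hi. apply definable_eq; lia. }
  assert (D1 : definable (d + 1) Q1).
  { apply definable_and; [apply definable_nodup|apply definable_all, D2]. }
  apply definable_ext with (2 := @definable_ex_list _ _ _ D1).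
  intros M [|x [|]] Hl; try discriminate. unfold unary, degree.
  assert (H2 : forall l y, length l = d -> (Q2 M (y :: l ++ [x]) <-> (edge R M x y <-> In y l))).
  { intros l y <-. unfold Q2. cbn [lookup_all nth_error].
    rewrite nth_error_app2, Nat.sub_diag by lia. cbn [nth_error].
    rewrite exists_Some, (nth_error_in l). cbn [binary].
    assert (H : (exists i, In i (seq 0 (length l)) /\ Some y = nth_error (l ++ [x]) i) <->
                exists i, In i (seq 0 (length l)) /\ nth_error l i = Some y).
    { split; intros (i & Hi & e); exists i; (split; [exact Hi|]); apply in_seq in Hi;
        rewrite nth_error_app1 in * by lia; auto. }
    rewrite H. tauto. }
  split.
  - intros (l & Ld & H & HE). exists l. split; [|split; [exact Ld|]].
    + apply nodup_positions with (l' := [x]). now rewrite Ld.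
    + intros y. apply H2; auto.
  - intros (l & N & Ld & HE). exists l. split; [exact Ld|]. split.
    + assert (N' := proj1 (nodup_positions l [x]) N). now rewrite Ld in N'.
    + intros y. apply H2; auto.
Qed.

(** The vertex [p] before [x] is carried along so that the next step can be compared with it. *)
Lemma definable_walk n : definable 3 (ternary (fun M p x y =>
  exists l, length l = n /\ nbwalk (edge R M) (p :: x :: l) /\ last l x = y)).
Proof.
  induction n as [|n IH].
  - apply definable_ext with (fun M v =>
      (exists t, lookup_all v [0; 1] = Some t /\ binary (edge R) M t) /\ nth_error v 1 = nth_error v 2).
    + intros M [|p [|x [|y [|]]]] Hl; try discriminate.
      cbn [lookup_all nth_error ternary]. rewrite exists_Some. cbn [binary]. split.
      * intros [H [= <-]]. exists []. simpl. auto.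
      * intros ([|] & L & W & <-); [|discriminate]. simpl in W. split; [tauto|reflexivity].
    + apply definable_and; [|apply definable_eq; lia].
      apply (definable_sub _ definable_edge); [reflexivity|]. intros i [<-|[<-|[]]]; lia.
  - apply definable_ext with (fun M v =>
      (exists t, lookup_all v [0; 1] = Some t /\ binary (edge R) M t) /\
      (* With [z] in front, positions 1, 2, 3 hold [p], [x], [y]; the recursive call is about [x],
         [z], [y]. *)
      exists z, (fun M u => nth_error u 0 <> nth_error u 1 /\
        exists t, lookup_all u [2; 0; 3] = Some t /\
          ternary (fun M p x y => exists l, length l = n /\ nbwalk (edge R M) (p :: x :: l) /\
             last l x = y) M t) M (z :: v)).
    + intros M [|p [|x [|y [|]]]] Hl; try discriminate.
      cbn [lookup_all nth_error ternary]. rewrite exists_Some. cbn [binary]. split.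
      * intros (Hpx & z & Hz & H). rewrite exists_Some in H. cbn [ternary] in H.
        destruct H as (l & L & W & HL). exists (z :: l). split; [simpl; auto|]. split.
        -- split; [exact Hpx|]. split; [congruence|exact W].
        -- now rewrite last_cons_default.
      * intros ([|z l] & L & (Hpx & Hpz & W) & HL); [discriminate|]. split; [exact Hpx|].
        exists z. split; [congruence|]. rewrite exists_Some. cbn [ternary]. exists l.
        rewrite last_cons_default in HL. auto.
    + apply definable_and.
      * apply (definable_sub _ definable_edge); [reflexivity|]. intros i [<-|[<-|[]]]; lia.
      * apply definable_ex with (Q := fun M u => nth_error u 0 <> nth_error u 1 /\
          exists t, lookup_all u [2; 0; 3] = Some t /\
            ternary (fun M p x y => exists l, length l = n /\ nbwalk (edge R M) (p :: x :: l) /\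
               last l x = y) M t).
        apply definable_and; [apply definable_not, definable_eq; lia|].
        apply (definable_sub _ IH); [reflexivity|]. intros i [<-|[<-|[<-|[]]]]; lia.
Qed.

Definition edge_axiom (M : structure ar) : Prop :=
  forall t, rel M R t -> exists a b, a <> b /\
    t = a :: repeat b (ar R - 1) /\ rel M R (b :: repeat a (ar R - 1)).

Lemma definable_edge_axiom : definable 0 (fun M _ => edge_axiom M).
Proof.
  apply definable_ext with (fun M v => forall l, length l = ar R ->
    (fun M u => (exists t, lookup_all u (seq 0 (ar R)) = Some t /\ rel M R t) ->
      nth_error u 0 <> nth_error u 1 /\
      (forall i, In i (seq 1 k) -> nth_error u i = nth_error u 1) /\
      exists t, lookup_all u [1; 0] = Some t /\ binary (edge R) M t) M (l ++ v)).
  - intros M [|] Hl; [|discriminate].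
    assert (Hseq : forall l : list (dom M), lookup_all l (seq 0 (length l)) = Some l).
    { intros l. induction l as [|x l IH]; [reflexivity|].
      cbn [length seq lookup_all nth_error]. rewrite <- seq_shift, lookup_all_shift, IH. reflexivity. }
    assert (Hrep : forall (l : list (dom M)) y, l = repeat y (length l) <->
              forall i, In i (seq 0 (length l)) -> nth_error l i = Some y).
    { intros l y. split.
      - intros e i Hi. apply in_seq in Hi. rewrite e. apply nth_error_repeat. lia.
      - intros H. induction l as [|z l IH]; [reflexivity|]. simpl. f_equal.
        + specialize (H 0 (or_introl eq_refl)). simpl in H. congruence.
        + apply IH. intros i Hi. apply (H (S i)). apply in_seq in Hi. apply in_seq. simpl. lia. }
    assert (Hone : forall a b (l : list (dom M)), length (a :: b :: l) = ar R ->
       ((forall i, In i (seq 1 k) -> nth_error (a :: b :: l) i = Some b) <->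
         a :: b :: l = a :: repeat b (ar R - 1))).
    { intros a b l L. assert (Lk : length (b :: l) = k) by (unfold k; simpl in *; lia).
      assert (E : b :: l = repeat b (length (b :: l)) <-> a :: b :: l = a :: repeat b (ar R - 1)).
      { fold k. rewrite Lk. split; [congruence|]. intros [= e]. exact e. }
      rewrite <- E, Hrep, Lk, <- seq_shift. split.
      - intros H i Hi. apply (H (S i)). now apply in_map.
      - intros H i Hi. apply in_map_iff in Hi. destruct Hi as (j & <- & Hj). now apply H. }
    split.
    + intros H t Ht. assert (L := rel_ar M R t Ht). specialize (H t L).
      rewrite app_nil_r in H. destruct H as (H1 & H2 & H3).
      { exists t. split; [|exact Ht]. rewrite <- L. apply Hseq. }
      destruct t as [|a [|b l]]; try (simpl in L; lia).
      cbn [lookup_all nth_error] in H3. rewrite exists_Some in H3. cbn [binary] in H3. exists a, b. split; [|split].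
      * cbn [nth_error] in H1. congruence.
      * now apply Hone.
      * exact H3.
    + intros H l L (t & e & Ht). rewrite app_nil_r in *. rewrite <- L, Hseq in e.
      injection e as <-. destruct l as [|a [|b l]]; try (simpl in L; lia).
      destruct (H _ Ht) as (a' & b' & Hn & e & Hba). cbn [lookup_all nth_error].
      assert (e' : a = a' /\ b = b').
      { fold k in e. assert (Hk : k = S (k - 1)) by (unfold k; lia). rewrite Hk in e.
        cbn [repeat] in e. injection e. auto. }
      destruct e' as [<- <-]. split; [congruence|]. split.
      * now apply Hone.
      * now rewrite exists_Some.
  - apply (@definable_all_list (ar R) 0 (fun M u =>
      (exists t, lookup_all u (seq 0 (ar R)) = Some t /\ rel M R t) ->
      nth_error u 0 <> nth_error u 1 /\
      (forall i, In i (seq 1 k) -> nth_error u i = nth_error u 1) /\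
      exists t, lookup_all u [1; 0] = Some t /\ binary (edge R) M t)).
    apply definable_imp; [|apply definable_and; [|apply definable_and]].
    + apply definable_rel. intros i Hi. apply in_seq in Hi. lia.
    + apply definable_not, definable_eq; lia.
    + apply definable_forall_in. intros i Hi. apply in_seq in Hi. unfold k in Hi.
      apply definable_eq; lia.
    + apply (definable_sub _ definable_edge); [reflexivity|]. intros i [<-|[<-|[]]]; lia.
Qed.

(** One walk length and one cardinality per sentence; only the conjunction over all [n] forbids
    cycles and gives infinitely many vertices of degree 4. The two walk clauses together exclude any
    walk of [S n] steps between vertices of degree 4. *)
Definition forest_axiom (n : nat) (M : structure ar) : Prop :=
  edge_axiom M /\
  (forall x, degree (edge R M) x 4 \/ degree (edge R M) x 5) /\
  (forall x l, length l = S n -> nbwalk (edge R M) (x :: l) -> last l x <> x) /\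
  (forall x l, length l = S n -> nbwalk (edge R M) (x :: l) ->
     degree (edge R M) x 4 -> degree (edge R M) (last l x) 4 -> last l x = x) /\
  (exists l, length l = n /\ NoDup l /\ forall x, In x l -> degree (edge R M) x 4).

Lemma definable_forest_axiom n : definable 0 (fun M _ => forest_axiom n M).
Proof.
  set (W := fun M p x y => exists l, length l = n /\ nbwalk (edge (ar := ar) R M) (p :: x :: l) /\
              last l x = y).
  assert (HW : forall M x (Q : dom M -> Prop),
    (forall l, length l = S n -> nbwalk (edge R M) (x :: l) -> Q (last l x)) <->
    forall z y, W M x z y -> Q y).
  { intros M x Q. split.
    - intros H z y (l & L & HW & <-). rewrite <- (last_cons_default x). apply H; simpl; auto.
    - intros H [|z l] L HW; [discriminate|]. rewrite last_cons_default. apply (H z).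
      exists l. simpl in L. auto. }
  assert (Dsub : forall m i, i < m -> definable m (fun M v => exists t, lookup_all v [i] = Some t /\
     unary (fun M x => degree (edge R M) x 4) M t)).
  { intros m i Hi. apply (definable_sub _ (definable_degree 4)); [reflexivity|]. intros j [<-|[]]; lia. }
  repeat apply definable_and.
  - apply definable_edge_axiom.
  - apply definable_ext with (fun M v => forall x,
      (fun M u => unary (fun M x => degree (edge R M) x 4) M u \/
                  unary (fun M x => degree (edge R M) x 5) M u) M (x :: v)).
    + intros M [|] Hl; [|discriminate]. reflexivity.
    + apply (definable_all (Q := fun M u => unary (fun M x => degree (edge R M) x 4) M u \/
                  unary (fun M x => degree (edge R M) x 5) M u)).
      apply definable_or; apply definable_degree.
  - apply definable_ext with (fun M v => forall l, length l = 2 ->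
      (fun M u => ~ exists t, lookup_all u [0; 1; 0] = Some t /\ ternary W M t) M (l ++ v)).
    + intros M [|] Hl; [|discriminate]. split.
      * intros H x. apply (HW M x (fun y => y <> x)). intros z y Hy ->.
        apply (H [x; z] eq_refl). cbn [app lookup_all nth_error]. now rewrite exists_Some.
      * intros H [|x [|z [|]]] L; try discriminate. cbn [app lookup_all nth_error].
        rewrite exists_Some. intros Hz. exact (proj1 (HW M x (fun y => y <> x)) (H x) z x Hz eq_refl).
    + apply (@definable_all_list 2 0 (fun M u =>
        ~ exists t, lookup_all u [0; 1; 0] = Some t /\ ternary W M t)).
      apply definable_not, (definable_sub _ (definable_walk n)); [reflexivity|].
      intros i [<-|[<-|[<-|[]]]]; lia.
  - apply definable_ext with (fun M v => forall l, length l = 3 ->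
      (fun M u => ternary W M u ->
         (exists t, lookup_all u [0] = Some t /\ unary (fun M x => degree (edge R M) x 4) M t) ->
         (exists t, lookup_all u [2] = Some t /\ unary (fun M x => degree (edge R M) x 4) M t) ->
         nth_error u 2 = nth_error u 0) M (l ++ v)).
    + intros M [|] Hl; [|discriminate]. split.
      * intros H x. apply (HW M x (fun y => degree (edge R M) x 4 -> degree (edge R M) y 4 -> y = x)).
        intros z y Hy Dx Dy. specialize (H [x; z; y] eq_refl). cbn [app lookup_all nth_error] in H.
        rewrite !exists_Some in H. specialize (H Hy Dx Dy). congruence.
      * intros H [|x [|z [|y [|]]]] L; try discriminate. cbn [app lookup_all nth_error].
        rewrite !exists_Some. intros Hy Dx Dy. f_equal.
        exact (proj1 (HW M x (fun y => degree (edge R M) x 4 -> degree (edge R M) y 4 -> y = x))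
                 (H x) z y Hy Dx Dy).
    + apply (@definable_all_list 3 0 (fun M u => ternary W M u ->
         (exists t, lookup_all u [0] = Some t /\ unary (fun M x => degree (edge R M) x 4) M t) ->
         (exists t, lookup_all u [2] = Some t /\ unary (fun M x => degree (edge R M) x 4) M t) ->
         nth_error u 2 = nth_error u 0)).
      apply definable_imp; [apply definable_walk|].
      apply definable_imp; [apply Dsub; lia|]. apply definable_imp; [apply Dsub; lia|].
      apply definable_eq; lia.
  - apply definable_ext with (fun M v => exists l, length l = n /\
      (fun M u => (forall i, In i (seq 0 n) -> forall j, In j (seq 0 n) ->
          nth_error u i = nth_error u j -> i = j) /\
        (forall i, In i (seq 0 n) -> exists t, lookup_all u [i] = Some t /\
          unary (fun M x => degree (edge R M) x 4) M t)) M (l ++ v)).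
    + intros M [|] Hl; [|discriminate].
      assert (H : forall l, length l = n ->
        ((forall i, In i (seq 0 n) -> exists t, lookup_all (l ++ []) [i] = Some t /\
          unary (fun M x => degree (edge R M) x 4) M t) <->
         forall x, In x l -> degree (edge R M) x 4)).
      { intros l <-. rewrite app_nil_r. split.
        - intros H x Hx. apply nth_error_in in Hx. destruct Hx as (i & Hi & e).
          specialize (H i Hi). cbn [lookup_all] in H. rewrite e in H. now rewrite exists_Some in H.
        - intros H i Hi. apply in_seq in Hi. cbn [lookup_all].
          destruct (nth_error l i) as [x|] eqn:e.
          + rewrite exists_Some. apply H. eapply nth_error_In; eauto.
          + apply nth_error_None in e. lia. }
      split; intros (l & L & H1 & H2); exists l; (split; [exact L|]); (split; [|now apply H]).
      * apply nodup_positions with (l' := []). now rewrite L.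
      * assert (N := proj1 (nodup_positions l []) H1). now rewrite L in N.
    + apply (@definable_ex_list n 0 (fun M u => (forall i, In i (seq 0 n) -> forall j, In j (seq 0 n) ->
          nth_error u i = nth_error u j -> i = j) /\
        (forall i, In i (seq 0 n) -> exists t, lookup_all u [i] = Some t /\
          unary (fun M x => degree (edge R M) x 4) M t))).
      apply definable_and; [apply definable_nodup|].
      apply definable_forall_in. intros i Hi. apply in_seq in Hi. apply Dsub. lia.
Qed.

End Definability.

(** * The theorem *)

Lemma countable_set_range (A X : Type) (val : A -> X) :
  countable_type A -> countable_set (fun x => exists a, x = val a).
Proof.
  intros [c Hc].
  exists (fun n => match excluded_middle_informative (exists a, c a = n) with
                   | left h => Some (val (proj1_sig (constructive_indefinite_description _ h)))
                   | right _ => None end).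
  intros x [a ->]. exists (c a).
  destruct (excluded_middle_informative (exists a', c a' = c a)) as [h|h].
  - destruct (constructive_indefinite_description _ h) as [a' Ha']. simpl.
    now rewrite (Hc _ _ Ha').
  - exfalso. eauto.
Qed.

Section Theories.
Variables (Sym : Type) (ar : Sym -> nat) (R : Sym).
Hypothesis Hsig : countable_type Sym.
Hypothesis HR : 2 <= ar R.

Definition theory_axiom (i : Sym + nat) (M : structure ar) : Prop :=
  match i with
  | inl s => s <> R -> rel_empty s M
  | inr n => forest_axiom R n M
  end.

Lemma theory_axiom_fo i : exists phi : fo_formula Sym,
  fo_sentence phi /\ forall M, fo_sat M [] phi <-> theory_axiom i M.
Proof.
  destruct i as [s|n].
  - apply (@definable_sentence _ _ (fun M _ => s <> R -> rel_empty s M)).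
    apply definable_imp; [apply definable_const|apply definable_rel_empty].
  - apply (@definable_sentence _ _ (fun M _ => forest_axiom R n M)).
    now apply definable_forest_axiom.
Qed.

Lemma theory_axiom_iso_closed i : iso_closed (theory_axiom i).
Proof.
  destruct (theory_axiom_fo i) as (phi & _ & H). intros M N HMN. rewrite <- !H.
  now apply fo_class_iso_closed.
Qed.

Lemma index_countable : countable_type (Sym + nat).
Proof.
  destruct Hsig as [c Hc].
  exists (fun i => match i with inl s => 2 * c s | inr n => 2 * n + 1 end).
  intros [s|n] [s'|n'] e; try lia; f_equal; [apply Hc|]; lia.
Qed.

Lemma finite_models n : exists M : structure ar,
  finite_str M /\ rigid M /\ connected M /\ inhabited (dom M) /\
  (forall s, theory_axiom (inl s) M) /\ (forall m, m <= n -> theory_axiom (inr m) M).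
Proof.
  (* The argument is [S n] because the axiom of index [m] speaks of walks with [S m] steps. *)
  destruct (rigid_graph_exists (S n)) as
    (V & E & Vfin & Vinh & Esym & Eirr & Econn & Edeg & Egirth & Esep & Emany & Erig).
  exists (graph_structure ar R HR E).
  assert (HG : is_Rgraph R (graph_structure ar R HR E)) by (apply graph_structure_Rgraph; auto).
  split; [exact Vfin|]. split; [now apply graph_structure_rigid|].
  split; [now apply graph_structure_connected|]. split; [exact Vinh|].
  split; [intros s Hs t; now apply HG|].
  intros m Hm. unfold theory_axiom, forest_axiom. rewrite graph_edge_eq by auto.
  split; [exact (proj2 HG)|]. split; [exact Edeg|]. split; [|split].
  - intros x l L W HL. change (@length V l = S m) in L.
    assert (e : l = []) by (apply (Egirth x l W HL); lia).
    subst l. discriminate.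
  - intros x l L W Dx Dl. change (@length V l = S m) in L. apply NNPP. intros Hn.
    assert (H : S n < @length V l); [|rewrite L in H; lia]. apply (Esep x l); auto.
  - destruct Emany as (l & N & L & H). exists (firstn m l). split; [|split].
    + rewrite length_firstn. lia.
    + rewrite <- (firstn_skipn m l) in N. now apply NoDup_app_remove_r in N.
    + intros x Hx. apply H. rewrite <- (firstn_skipn m l). apply in_or_app; auto.
Qed.

Section Property.
Variables (P : structure ar -> Prop) (TR TR' : structure ar).
Hypothesis HP : iso_closed P.
Hypothesis HTR : is_TR R TR.
Hypothesis HTR' : is_TR' R TR'.
Hypothesis H1 : forall N : structure ar,
  finite_str N -> rigid N -> connected N -> inhabited (dom N) -> P N.
Hypothesis H2 : forall (I J : Type) (T : I -> structure ar) (T' : J -> structure ar),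
  infinite_type I -> (forall i, iso (T i) TR) -> (forall j, iso (T' j) TR') ->
  ~ P (disj_union T T').

Lemma theory_refutes M : (forall i, theory_axiom i M) -> ~ P M.
Proof.
  intros HA HPM.
  assert (HM : is_Rgraph R M).
  { split; [intros s t Hs; exact (HA (inl s) Hs t)|]. exact (proj1 (HA (inr 0))). }
  destruct (@forest_decomposition _ ar R HR TR TR' M HTR HTR' HM) as
    (I & J & T & T' & HI & HT & HT' & Hiso).
  - exact (proj1 (proj2 (HA (inr 0)))).
  - intros r x [|y l] W HL _; [reflexivity|exfalso].
    destruct (HA (inr (length l))) as (_ & _ & Hg & _).
    exact (Hg x (y :: l) eq_refl W HL).
  - intros v w Dv Dw Hvw. apply connected_nb_within in Hvw.
    destruct Hvw as (k & [|y l] & W & <- & _); [reflexivity|].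
    destruct (HA (inr (length l))) as (_ & _ & _ & Hs & _). symmetry.
    exact (Hs v (y :: l) eq_refl W Dv Dw).
  - intros [L HL].
    (* This axiom supplies one more vertex of degree 4 than the supposed enumeration [L] can
       hold. *)
    destruct (HA (inr (S (length L)))) as (_ & _ & _ & _ & l & Ll & N & Hl).
    assert (Hle : length l <= length (map (@proj1_sig _ _) L)).
    { apply NoDup_incl_length; [exact N|]. intros x Hx.
      apply in_map_iff. exists (exist _ x (Hl x Hx)). auto. }
    rewrite length_map in Hle. lia.
  - apply (H2 HI HT HT'). exact (HP (iso_sym Hiso) HPM).
Qed.

Lemma property_models : exists Ms : nat -> structure ar, forall n,
  P (Ms n) /\ inhabited (dom (Ms n)) /\
  (forall s, theory_axiom (inl s) (Ms n)) /\ (forall m, m <= n -> theory_axiom (inr m) (Ms n)).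
Proof.
  exists (fun n => proj1_sig (constructive_indefinite_description _ (finite_models n))).
  intros n. destruct (constructive_indefinite_description _ (finite_models n)) as [M HM].
  cbn [proj1_sig]. destruct HM as (F & Rg & C & I & A & B). auto.
Qed.

Theorem not_fo_expressible : ~ fo_expresses P.
Proof.
  intros (phi & _ & Hphi). destruct property_models as (Ms & HMs).
  destruct (fo_limit_model Ms) as (M & HM); [intros n; apply HMs|].
  apply (@theory_refutes M).
  - intros i. destruct (theory_axiom_fo i) as (psi & _ & Hpsi). apply Hpsi, HM.
    destruct i as [s|m]; [exists 0|exists m]; intros n Hn; apply Hpsi; now apply HMs.
  - apply Hphi, HM. exists 0. intros n _. apply Hphi, HMs.
Qed.

(** * Abstract logics that express the property *)

Section Logic.
Variable L : abstract_logic ar.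
Hypothesis HL : fo_le L.
Hypothesis HLP : expresses L P.

Lemma translation : exists tr : Sym + nat -> al_form L, forall i,
  al_sentence L (tr i) /\ forall M, al_sat L M (tr i) <-> theory_axiom i M.
Proof.
  assert (H : forall i, exists phi, al_sentence L phi /\
            forall M, al_sat L M phi <-> theory_axiom i M).
  { intros i. exact (HL (@theory_axiom_iso_closed i) (theory_axiom_fo i)). }
  exists (fun i => proj1_sig (constructive_indefinite_description _ (H i))).
  intros i. apply (proj2_sig (constructive_indefinite_description _ (H i))).
Qed.

(** A late member of the sequence works: the first kind of formula holds at every index, each axiom
    from some index on. The first kind admits the sentence for [P] in the compactness argument; the
    premises of a proof are axioms only. *)
Lemma finitely_satisfiable (tr : Sym + nat -> al_form L)
  (Htr : forall i M, al_sat L M (tr i) <-> theory_axiom i M) (l : list (al_form L)) :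
  (forall phi, In phi l -> (forall M, P M -> al_sat L M phi) \/ exists i, phi = tr i) ->
  exists M, P M /\ forall phi, In phi l -> al_sat L M phi.
Proof.
  intros Hl. destruct property_models as (Ms & HMs).
  assert (H : exists k, forall n, k <= n -> forall phi, In phi l -> al_sat L (Ms n) phi).
  { induction l as [|phi l IH]; [exists 0; intros _ _ _ []|].
    destruct IH as [k Hk]; [intros; apply Hl; simpl; auto|].
    destruct (Hl phi (or_introl eq_refl)) as [Hphi|([s|m] & ->)].
    - exists k. intros n Hn psi [<-|Hpsi]; [apply Hphi, HMs|eauto].
    - exists k. intros n Hn psi [<-|Hpsi]; [apply Htr, HMs|eauto].
    - exists (k + m). intros n Hn psi [<-|Hpsi].
      + apply Htr, HMs. lia.
      + apply (Hk n); [lia|exact Hpsi]. }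
  destruct H as [k Hk]. exists (Ms k). split; [apply HMs|]. apply Hk. apply le_n.
Qed.

Theorem not_compact : ~ aleph0_compact L.
Proof.
  intros HC. destruct translation as (tr & Htr). destruct HLP as (phi & _ & Hphi).
  (* [None] stands for the sentence that expresses [P]. *)
  set (val := fun o => match o with Some i => tr i | None => phi end).
  destruct (HC (fun psi => exists o, psi = val o)) as (M & HM).
  - apply countable_set_range. destruct index_countable as [c Hc].
    exists (fun o => match o with Some i => S (c i) | None => 0 end).
    intros [i|] [j|] e; try discriminate; [|reflexivity]. f_equal. apply Hc. congruence.
  - intros l Hl. destruct (@finitely_satisfiable tr (fun i => proj2 (Htr i)) l) as (M & _ & HM).
    + intros psi Hpsi. destruct (Hl psi Hpsi) as ([i|] & ->); [right; exists i; reflexivity|left].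
      intros M HM. now apply Hphi.
    + exists M. exact HM.
  - apply (@theory_refutes M).
    + intros i. apply Htr, HM. exists (Some i). reflexivity.
    + apply Hphi, HM. exists None. reflexivity.
Qed.

Theorem no_sound_complete_system : closed_neg L ->
  ~ exists PS : proof_system L, ps_sound PS /\ ps_complete PS.
Proof.
  intros HN (PS & Hsound & Hcomplete). destruct translation as (tr & Htr).
  destruct HLP as (phi & Sphi & Hphi). destruct (HN phi Sphi) as (psi & Spsi & Hpsi).
  destruct (Hcomplete (fun chi => exists i, chi = tr i) psi) as (pi & Hc & Hp).
  - intros chi [i ->]. apply Htr.
  - exact Spsi.
  - intros M HM. apply NNPP. intros H. apply (@theory_refutes M).
    + intros i. apply Htr, HM. eauto.
    + now apply Hphi, Hpsi.
  - destruct (@finitely_satisfiable tr (fun i => proj2 (Htr i)) (ps_prem PS pi)) as (M & HPM & HM).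
    + intros chi Hchi. right. now apply Hp.
    + apply Hphi, Hpsi in HPM. apply HPM. rewrite <- Hc. apply Hsound.
      * now rewrite Hc.
      * intros chi Hchi. destruct (Hp chi Hchi) as [i ->]. apply Htr.
      * exact HM.
Qed.

End Logic.
End Property.
End Theories.

Theorem theorem2p2 (Sym : Type) (ar : Sym -> nat)
  (Hsig : countable_type Sym) (R : Sym) (HR : 2 <= ar R)
  (P : structure ar -> Prop) (HP : iso_closed P)
  (TR TR' : structure ar) (HTR : is_TR R TR) (HTR' : is_TR' R TR')
  (H1 : forall N : structure ar, finite_str N -> rigid N -> connected N ->
          inhabited (dom N) -> P N)
  (H2 : forall (I J : Type) (T : I -> structure ar) (T' : J -> structure ar),
          infinite_type I -> (forall i, iso (T i) TR) -> (forall j, iso (T' j) TR') ->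
          ~ P (disj_union T T')) :
  ~ fo_expresses P /\
  (forall L : abstract_logic ar, fo_le L -> expresses L P -> ~ aleph0_compact L) /\
  (forall L : abstract_logic ar, fo_le L -> closed_neg L -> expresses L P ->
     ~ exists PS : proof_system L, ps_sound PS /\ ps_complete PS).
Proof.
  split; [|split].
  - eapply not_fo_expressible; eauto.
  - intros L HL HLP. eapply not_compact; eauto.
  - intros L HL HN HLP. eapply no_sound_complete_system; eauto.
Qed.
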